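(* Fix integers $k\ge2$ and $d\ge 2$ with $k\le d$, and suppose that the $d$-variate copula $C$ satisfies the second-order regularity condition for $k$-variate margins with constant $K$ (stated in the context). Then there exist constants $L_1,L_2>0$ depending only on $k$ and $K$ such that, for any $\delta>0$ and $n\in\mathbb N$ with $e^{-n/32}\le\delta\le e^{-1}$, \[ \sup_{\boldsymbol u\in W_k}|\mathbb C_n(\boldsymbol u)-\bar{\mathbb C}_n(\boldsymbol u)|\le \frac{2k}{\sqrt n}+L_1\sqrt{r\log\Big(\frac{L_2}{\delta r}\Big)} \] with probability at least $1-(9d+d^k)\delta$, where \[ r=r_{n,\delta}=\sqrt{\frac1{2n}\log\Big(\frac1\delta\Big)} . \]
   Context: Setting. $\boldsymbol X_1,\dots,\boldsymbol X_n$ are i.i.d. random vectors in $\mathbb R^{d}$, $\boldsymbol X_i=(X_{i1},\dots,X_{id})$, with continuous marginal cdfs $F_1,\dots,F_d$ and (unique) copula $C$. Put $U_{ij}=F_j(X_{ij})$, $\boldsymbol U_i=(U_{i1},\dots,U_{id})$; $R_{ij}$ is the (max-)rank of $X_{ij}$ among $X_{1j},\dots,X_{nj}$ and $\hat U_{ij}=R_{ij}/n$, $\hat{\boldsymbol U}_i=(\hat U_{i1},\dots,\hat U_{id})$. Inequalities between vectors are componentwise. Empirical copula: $\hat C_n(\boldsymbol u)=\frac1n\sum_{i=1}^n \mathbf 1(\hat{\boldsymbol U}_i\le \boldsymbol u)$; empirical copula process: $\mathbb C_n(\boldsymbol u)=\sqrt n\{\hat C_n(\boldsymbol u)-C(\boldsymbol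 u)\}$, $\boldsymbol u\in[0,1]^d$. Standard empirical process: $\alpha_n(\boldsymbol u)=n^{-1/2}\sum_{i=1}^n\{\mathbf 1(\boldsymbol U_i\le\boldsymbol u)-C(\boldsymbol u)\}$, with $j$-th margin $\alpha_{nj}(u_j)=\alpha_n(1,\dots,1,u_j,1,\dots,1)$ ($u_j$ at position $j$). Linearization: $\bar{\mathbb C}_n(\boldsymbol u)=\alpha_n(\boldsymbol u)-\sum_{j=1}^d \dot C_j(\boldsymbol u)\alpha_{nj}(u_j)$. Here $\dot C_j(\boldsymbol u)=\lim_{h\to0}\{C(\boldsymbol u+h\boldsymbol e_j)-C(\boldsymbol u)\}/h$ for $u_j\in(0,1)$, $\dot C_j(\boldsymbol u)=\limsup_{h\downarrow0}\{C(\boldsymbol u+h\boldsymbol e_j)-C(\boldsymbol u)\}/h$ if $u_j=0$, and $\dot C_j(\boldsymbol u)=\limsup_{h\downarrow0}\{C(\boldsymbol u-h\boldsymbol e_j)-C(\boldsymbol u)\}/(-h)$ if $u_j=1$. Since $\alpha_{nj}(1)=0$, only indices $j$ with $u_j<1$ contribute to the sum. Sets: $W_k=\{\boldsymbol u\in[0,1]^d: |\{j:u_j<1\}|\le k\}$ and $V_j=\{\boldsymbol u\in[0,1]^d:u_j\in(0,1)\}$. Second-order regularity condition for $k$-variate margins (with constant $K$): for each $j\in\{1,\dots,d\}$ the first-order partial derivative $\dot C_j$ exists and is continuous on $V_j\cap W_k$; for each $i,j\in\{1,\dots,d\}$ the second-order partial derivative $\ddot C_{ij}$ exists and is continuous on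 $V_i\cap V_j\cap W_k$; and for all $i,j\in\{1,\dots,d\}$ and all $\boldsymbol u\in V_i\cap V_j\cap W_k$, \[|\ddot C_{ij}(\boldsymbol u)|\le K\min\Big(\frac1{u_j(1-u_j)},\frac1{u_i(1-u_i)}\Big).\] *)

(* Defs.v *)
From HB Require Import structures.
From mathcomp Require Export all_boot all_order all_algebra.
From mathcomp Require Export all_classical all_reals all_analysis.

Set Implicit Arguments.
Unset Strict Implicit.
Unset Printing Implicit Defensive.

Import Order.TTheory GRing.Theory Num.Theory.
Import numFieldTopology.Exports numFieldNormedType.Exports.

Local Open Scope classical_set_scope.
Local Open Scope ring_scope.

(* Points of R^d at which functions are differentiated are row vectors 'rV[R]_d
   (a normed space); values of random vectors are d-tuples (a measurable space,
   carrying the product of the Borel sigma-algebras). *)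

Section distributions.
Context {R : realType} {d : nat}.
Implicit Types (mu : probability (d.-tuple R) R) (C : 'rV[R]_d -> R).

Definition joint_cdf mu (x : 'rV[R]_d) : R :=
  fine (mu [set y | forall j, tnth y j <= x 0 j]).

Definition marginal_cdf mu (j : 'I_d) (x : R) : R :=
  fine (mu [set y | tnth y j <= x]).

Definition unit_cube : set 'rV[R]_d := [set u | forall j, 0 <= u 0 j <= 1].

(* Only the values of C on the unit cube are meaningful. *)
Definition is_copula C : Prop :=
  exists nu : probability (d.-tuple R) R,
    (forall j t, 0 <= t <= 1 -> marginal_cdf nu j t = t) /\
    (forall u, unit_cube u -> C u = joint_cdf nu u).

(* The second clause is the identity in Sklar's theorem. *)
Definition copula_of C mu : Prop :=
  is_copula C /\
  forall x, joint_cdf mu x = C (\row_j marginal_cdf mu j (x 0 j)).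

End distributions.

Section iid.
Context {R : realType} {d : nat} {disp : measure_display}
  {Omega : measurableType disp} (P : probability Omega R) {n : nat}.

(* As some of the B i may be the whole space, the product rule for the full
   family contains the product rule for all its subfamilies. *)
Definition independent_vectors (X : 'I_n -> {RV P >-> d.-tuple R}) : Prop :=
  forall B : 'I_n -> set (d.-tuple R), (forall i, measurable (B i)) ->
    P [set w | forall i, B i (X i w)] = (\prod_(i < n) P (X i @^-1` B i))%E.

Definition iid_sample (X : 'I_n -> {RV P >-> d.-tuple R})
    (mu : probability (d.-tuple R) R) : Prop :=
  independent_vectors X /\
  forall i (B : set (d.-tuple R)), measurable B -> distribution P (X i) B = mu B.

End iid.

Section regularity.
Context {R : realType} {d : nat}.
Implicit Types (C : 'rV[R]_d -> R) (i j : 'I_d) (u : 'rV[R]_d).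

Definition basis_vec j : 'rV[R]_d := delta_mx 0 j.

(* On the cube the limsups are finite for a copula, so [fine] loses nothing. *)
Definition dotC C j u : R :=
  if u 0 j == 0 then
    fine (limf_esup (fun h : R => ((C (u + h *: basis_vec j) - C u) / h)%:E) 0^'+)
  else if u 0 j == 1 then
    fine (limf_esup (fun h : R => ((C (u - h *: basis_vec j) - C u) / - h)%:E) 0^'+)
  else 'D_(basis_vec j) C u.

Definition ddotC C i j u : R := 'D_(basis_vec i) (dotC C j) u.

Definition W (k : nat) : set 'rV[R]_d :=
  [set u | unit_cube u /\ (#|[pred j : 'I_d | (u 0 j < 1)%R]| <= k)%N].

Definition V j : set 'rV[R]_d := [set u | unit_cube u /\ 0 < u 0 j < 1].

Definition second_order_regular C (k : nat) (K : R) : Prop :=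
  [/\ forall j,
        (forall u, (V j `&` W k) u -> derivable C u (basis_vec j)) /\
        {within V j `&` W k, continuous (dotC C j)},
      forall i j,
        (forall u, (V i `&` V j `&` W k) u ->
           derivable (dotC C j) u (basis_vec i)) /\
        {within V i `&` V j `&` W k, continuous (ddotC C i j)}
    & forall i j u, (V i `&` V j `&` W k) u ->
        `|ddotC C i j u| <=
          K * Num.min (u 0 j * (1 - u 0 j))^-1 (u 0 i * (1 - u 0 i))^-1].

End regularity.

Section processes.
Context {R : realType} {d n : nat}.
Implicit Types (x : 'I_n -> d.-tuple R) (C : 'rV[R]_d -> R)
  (F : 'I_d -> R -> R) (i : 'I_n) (j : 'I_d) (u : 'rV[R]_d).

Definition max_rank x i j : nat :=
  #|[pred l : 'I_n | (tnth (x l) j <= tnth (x i) j)%R]|.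

Definition pseudo_obs x i j : R := (max_rank x i j)%:R / n%:R.

Definition empirical_copula x u : R :=
  n%:R^-1 * \sum_(i < n) [forall j, pseudo_obs x i j <= u 0 j]%:R.

Definition empirical_copula_process C x u : R :=
  Num.sqrt n%:R * (empirical_copula x u - C u).

Definition alpha F C x u : R :=
  (Num.sqrt n%:R)^-1 *
  \sum_(i < n) ([forall j, F j (tnth (x i) j) <= u 0 j]%:R - C u).

Definition alpha_margin F C x j (t : R) : R :=
  alpha F C x (\row_l if l == j then t else 1).

Definition linearization F C x u : R :=
  alpha F C x u - \sum_(j < d) dotC C j u * alpha_margin F C x j (u 0 j).

End processes.

Definition rate {R : realType} (n : nat) (delta : R) : R :=
  Num.sqrt ((2 * n%:R)^-1 * ln delta^-1).

(* Main.v *)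
From HB Require Import structures.
Require Import Defs.
From mathcomp Require Import measurable_realfun ring lra.

(** Uniformizing the margins turns the sample into points [U_i] with law [C]
    and [n * empirical_copula u] into the number of points below a vector [v] of
    empirical quantiles of [u], with [v - u] of order [rate].  Hence the error
    splits into an oscillation of the empirical process over distance [rate],
    and the remainder of a first-order expansion of [C] between [u] and [v].
    Oscillations on [W k] are controlled by a Bernstein inequality on grids of
    dimension [k].  The second derivatives may blow up at the boundary like
    [1 / t(1-t)], but the same grid bound shows that [(v_j - u_j)^2] is at most
    of order [u_j (1 - u_j) log(n/delta) / n], which compensates exactly; the
    coordinates at distance less than a multiple of [rate] from the boundary
    are treated with the Lipschitz property of [C].  A uniform bound on the
    marginal processes free of logarithms is obtained by dyadic chaining. *)

Set Implicit Arguments.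
Unset Strict Implicit.
Unset Printing Implicit Defensive.

Import Order.TTheory GRing.Theory Num.Theory.
Import numFieldTopology.Exports numFieldNormedType.Exports.

Local Open Scope classical_set_scope.
Local Open Scope ring_scope.

(** Two requirements shape the estimates. The constants may not depend on [d]: a point of [W k] has
    at most [k] coordinates below 1 and coordinates equal to 1 are never moved, so sums over
    coordinates have at most [k] nonzero terms; [d] enters only through the failure probability,
    where [d^k] counts the choices of coordinates. Moreover [v - u] must have the exact order of
    [rate]: the grid bound alone would give [sqrt (log (n / delta) / n)] and leave a power of the
    logarithm too many in the oscillation over that distance; hence the chaining of the margins. The
    logarithmic level of the grid bound, of order [k log (n / delta)], is harmless, since
    [n / delta] is at most [(1 / (delta r))^2]. All randomness is confined to three events: grid
    increments, at cost [d^k delta]; marginal suprema, at cost [d delta]; absence of zeros and ties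
    among the uniformized observations, at cost [delta]. On their intersection the argument is
    deterministic and covers all [u] at once. *)

Section finite_probability.
Context {R : realType} {d : measure_display} {T : measurableType d}
  (P : probability T R).
Implicit Types (A B : set T) (Q : T -> Prop) (e : R).

Definition pr A : R := fine (P A).

Lemma prE A : measurable A -> P A = (pr A)%:E.
Proof. by move=> mA; rewrite /pr fineK // fin_num_measure. Qed.

Lemma pr_ge0 A : 0 <= pr A.
Proof. by rewrite fine_ge0. Qed.

Lemma le_pr A B : measurable A -> measurable B -> A `<=` B -> pr A <= pr B.
Proof.
by move=> mA mB AB; rewrite -lee_fin -!prE//; apply: le_measure; rewrite ?inE.
Qed.

Lemma prT : pr setT = 1.
Proof. by rewrite /pr probability_setT. Qed.

Lemma pr0 : pr set0 = 0.
Proof. by rewrite /pr measure0. Qed.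

Lemma pr_le1 A : measurable A -> pr A <= 1.
Proof. by move=> mA; rewrite -prT; exact: le_pr. Qed.

Lemma pr_setC A : measurable A -> pr (~` A) = 1 - pr A.
Proof.
move=> mA; apply: EFin_inj; rewrite -prE; last exact: measurableC.
by rewrite probability_setC// prE.
Qed.

Lemma prU A B : measurable A -> measurable B -> pr (A `|` B) <= pr A + pr B.
Proof.
move=> mA mB; rewrite -lee_fin EFinD -!prE//; last exact: measurableU.
exact: measureU2.
Qed.

Lemma prD A B : measurable A -> measurable B -> B `<=` A ->
  pr (A `\` B) = pr A - pr B.
Proof.
move=> mA mB BA; apply: EFin_inj; rewrite EFinB -!prE//; last exact: measurableD.
rewrite measureD//; first by congr (_ - P _)%E; apply/setIidPr.
by apply: le_lt_trans (ltry 1); exact: probability_le1.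
Qed.

Lemma pr_bigU (I : Type) (s : seq I) (p : pred I) (F : I -> set T) :
  (forall i, measurable (F i)) ->
  pr (\big[setU/set0]_(i <- s | p i) F i) <= \sum_(i <- s | p i) pr (F i).
Proof.
move=> mF; elim: s => [|i s IH]; first by rewrite !big_nil pr0.
rewrite !big_cons; case: ifP => // _.
apply: le_trans (prU _ _) _ => //; first exact: bigsetU_measurable.
by rewrite lerD2l.
Qed.

(** [Q] may quantify over a continuum of points and need not be an event, so the probability is
    attached to a measurable set on which [Q] holds. *)
Definition fails_with_pr e Q :=
  exists A, [/\ measurable A, pr (~` A) <= e & forall w, A w -> Q w].

Lemma fails_with_pr_mono e e' Q Q' : e <= e' -> (forall w, Q w -> Q' w) ->
  fails_with_pr e Q -> fails_with_pr e' Q'.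
Proof.
move=> ee QQ [A [mA Ae AQ]]; exists A; split => //; first exact: le_trans ee.
by move=> w /AQ/QQ.
Qed.

Lemma fails_with_pr_and e e' Q Q' : fails_with_pr e Q -> fails_with_pr e' Q' ->
  fails_with_pr (e + e') (fun w => Q w /\ Q' w).
Proof.
move=> [A [mA Ae AQ]] [B [mB Be BQ]]; exists (A `&` B); split.
- exact: measurableI.
- rewrite setCI; apply: le_trans (prU _ _) _; try exact: measurableC.
  exact: lerD.
- by move=> w [/AQ ? /BQ].
Qed.

Lemma fails_with_pr_true e : 0 <= e -> fails_with_pr e (fun=> True).
Proof. by move=> e0; exists setT; rewrite setCT pr0; split. Qed.

Lemma fails_with_pr_all (I : finType) (e : I -> R) (Q : I -> T -> Prop) :
  (forall i, fails_with_pr (e i) (Q i)) ->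
  fails_with_pr (\sum_i e i) (fun w => forall i, Q i w).
Proof.
move=> H.
suff : fails_with_pr (\sum_(i <- index_enum I) e i)
    (fun w => forall i, i \in index_enum I -> Q i w).
  by apply: fails_with_pr_mono => // w h i; apply: h; rewrite mem_index_enum.
elim: (index_enum I) => [|i s IH].
  by rewrite big_nil; apply: fails_with_pr_mono (fails_with_pr_true _).
rewrite big_cons; apply: fails_with_pr_mono (fails_with_pr_and (H i) IH) => //.
by move=> w [Hi Hs] j; rewrite inE => /predU1P[->//|]; exact: Hs.
Qed.

Lemma fails_with_pr_all_const (I : finType) e (Q : I -> T -> Prop) :
  (forall i, fails_with_pr e (Q i)) ->
  fails_with_pr (#|I|%:R * e) (fun w => forall i, Q i w).
Proof.
move=> H; apply: fails_with_pr_mono (fails_with_pr_all H) => //.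
by rewrite sumr_const mulr_natl.
Qed.

End finite_probability.

(** From [expR (- x) >= 1 - x] one gets [expR x <= 1 / (1 - x)], and [(1 + x + 2 x^2) (1 - x) = 1 +
    x^2 (1 - 2 x)] is at least 1 for [x <= 1 / 2]. Negative [x] serve the lower tail. *)
Lemma expR_le_quadratic {R : realType} (x : R) : x <= 1 / 2 ->
  expR x <= 1 + x + 2 * x ^+ 2.
Proof.
move=> x12; have x1 : 0 < 1 - x by lra.
have e0 := expR_gt0 (- x).
have h : 1 - x <= expR (- x) by exact: expR_ge1Dx.
rewrite -[expR x]invrK -expRN -[leLHS]mul1r ler_pdivrMr//.
have : 1 <= (1 + x + 2 * x ^+ 2) * (1 - x) by nra.
have : 0 <= 1 + x + 2 * x ^+ 2 by nra.
by move=> /ler_wpM2l/(_ _ _ h); lra.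
Qed.

(** * Bernstein inequality for the number of sample points in a set *)

Section concentration.
Context {R : realType} {d : nat} {disp : measure_display}
  {Omega : measurableType disp} (P : probability Omega R) {n : nat}
  (X : 'I_n -> {RV P >-> d.-tuple R}) (mu : probability (d.-tuple R) R).
Hypothesis iid : iid_sample X mu.
Implicit Types (B : set (d.-tuple R)).

Definition count B (w : Omega) : R := \sum_(i < n) (`[< B (X i w) >])%:R.

Definition deviation B (w : Omega) : R := count B w - n%:R * pr mu B.

Definition pattern B (f : {ffun 'I_n -> bool}) : set Omega :=
  [set w | forall i, (if f i then B else ~` B) (X i w)].

Lemma measurable_pattern B f : measurable B -> measurable (pattern B f).
Proof.
move=> mB; rewrite (_ : pattern B f =
    \bigcap_(i in [set: 'I_n]) (X i @^-1` (if f i then B else ~` B))).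
  apply: fin_bigcap_measurable => // i _; rewrite -[_ @^-1` _]setTI.
  by apply: measurable_funPT => //; case: (f i) => //; exact: measurableC.
by apply/seteqP; split => [w h i _|w h i]; [exact: h|exact: (h i)].
Qed.

Lemma pr_pattern B f : measurable B ->
  pr P (pattern B f) = \prod_(i < n) (if f i then pr mu B else 1 - pr mu B).
Proof.
move=> mB; have [ind law] := iid; have mD i : measurable (if f i then B else ~` B).
  by case: (f i) => //; exact: measurableC.
rewrite /pr /pattern (ind (fun i => if f i then B else ~` B))//.
rewrite (_ : (\prod_(i < n) _)%E =
    (\prod_(i < n) (if f i then pr mu B else 1 - pr mu B))%:E)//.
rewrite -prodEFin; apply: eq_bigr => i _.
have -> : P (X i @^-1` (if f i then B else ~` B)) = mu (if f i then B else ~` B).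
  by rewrite -(law i).
by case: (f i); rewrite prE// ?pr_setC//; exact: measurableC.
Qed.

Lemma count_pattern B f w : pattern B f w ->
  count B w = \sum_(i < n) (f i)%:R.
Proof.
move=> h; apply: eq_bigr => i _; congr (nat_of_bool _)%:R.
by have := h i; case: (f i) => hi; apply/asboolP.
Qed.

(* The moment generating function is computed as a finite sum over the patterns
   of membership of the sample in [B], whence no integration. *)
Lemma chernoff B (lam s : R) : measurable B -> lam <= 1 / 2 ->
  fails_with_pr P (expR (2 * n%:R * pr mu B * lam ^+ 2 - s))
    (fun w => lam * deviation B w < s).
Proof.
move=> mB lam12; set p := pr mu B.
have p0 : 0 <= p by exact: pr_ge0.
have p1 : p <= 1 by exact: pr_le1.
pose bad (f : {ffun 'I_n -> bool}) : bool :=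
  s <= lam * (\sum_(i < n) (f i)%:R - n%:R * p).
pose Bad := \big[setU/set0]_(f | bad f) pattern B f.
have mBad : measurable Bad.
  by apply: bigsetU_measurable => f _; exact: measurable_pattern.
exists (~` Bad); split; first exact: measurableC.
- rewrite setCK; apply: le_trans (pr_bigU _ _ _ _) _ => [f|].
    exact: measurable_pattern.
  (* Exponential Markov inequality: the weight is at least 1 on a bad pattern and nonnegative on the
     others. *)
  apply: (@le_trans _ _ (\sum_(f : {ffun 'I_n -> bool}) expR (lam * (\sum_(i < n) (f i)%:R - n%:R * p) - s)
      * pr P (pattern B f))).
    rewrite big_mkcond/=; apply: ler_sum => f _; have := pr_ge0 P (pattern B f).
    rewrite /bad; case: ifP => [h pf|_ pf]; last by rewrite mulr_ge0// expR_ge0.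
    by apply: ler_peMl => //; rewrite -[leLHS]expR0 ler_expR subr_ge0.
  rewrite (eq_bigr (fun f : {ffun 'I_n -> bool} => expR (- (lam * n%:R * p) - s) *
     \prod_(i < n) (if f i then expR lam * p else 1 - p))); last first.
    move=> f _; rewrite pr_pattern//.
    rewrite (_ : lam * _ - s = - (lam * n%:R * p) - s + \sum_(i < n) lam * (f i)%:R);
      last by rewrite -mulr_sumr; ring.
    rewrite expRD -mulrA; congr (_ * _).
    rewrite expR_sum -big_split/=; apply: eq_bigr => i _.
    by case: (f i); rewrite /= ?mulr1// mulr0 expR0 mul1r.
  rewrite -mulr_sumr -(bigA_distr_bigA (fun (i : 'I_n) (b : bool) =>
     if b then expR lam * p else 1 - p)).
  rewrite (eq_bigr (fun=> 1 + p * (expR lam - 1))); last first.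
    by move=> i _; rewrite big_bool/=; ring.
  rewrite prodr_const card_ord.
  have h : 1 + p * (expR lam - 1) <= expR (p * (lam + 2 * lam ^+ 2)).
    apply: le_trans (expR_ge1Dx _); rewrite lerD2l ler_wpM2l//.
    by have := expR_le_quadratic lam12; lra.
  have h0 : 0 <= 1 + p * (expR lam - 1).
    have := expR_gt0 lam; nra.
  apply: (@le_trans _ _ (expR (- (lam * n%:R * p) - s) *
      expR (p * (lam + 2 * lam ^+ 2)) ^+ n)).
    by rewrite ler_wpM2l ?expR_ge0//; apply: lerXn2r; rewrite ?nnegrE ?expR_ge0.
  rewrite -expRM_natl -expRD ler_expR; lra.
- move=> w nb; rewrite ltNge; apply/negP => hs; apply: nb.
  pose f : {ffun 'I_n -> bool} := [ffun i => `[< B (X i w) >]].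
  have pf : pattern B f w.
    by move=> i; rewrite ffunE; case: asboolP.
  by rewrite /Bad -bigcup_seq_cond; exists f; rewrite //= mem_index_enum/=;
    rewrite /bad -(count_pattern pf).
Qed.

(** This is [chernoff] at [lam = sqrt (l / (n q)) / 2], up to sign; [l <= n q] is what makes
    [lam <= 1 / 2]. With [s = 3 / 2 l] the exponent is at most [l / 2 - s = - l], and the threshold
    [s / lam = 3 sqrt (n q l)] is below the stated one. *)
Lemma bernstein B (q l : R) : measurable B -> pr mu B <= q ->
  0 < l -> l <= n%:R * q ->
  fails_with_pr P (2 * expR (- l))
    (fun w => `|deviation B w| <= 4 * Num.sqrt (n%:R * q * l)).
Proof.
move=> mB Bq l0 lnq.
have nq0 : 0 < n%:R * q by exact: lt_le_trans lnq.
set x := Num.sqrt (n%:R * q); set y := Num.sqrt l.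
have x0 : 0 < x by rewrite sqrtr_gt0.
have y0 : 0 < y by rewrite sqrtr_gt0.
have xx : x ^+ 2 = n%:R * q by rewrite sqr_sqrtr// ltW.
have yy : y ^+ 2 = l by rewrite sqr_sqrtr// ltW.
have yx : y <= x by exact: ler_wsqrtr.
have -> : Num.sqrt (n%:R * q * l) = x * y by rewrite sqrtrM// ltW.
pose lam := y / x / 2.
have lamx : lam * x = y / 2 by rewrite /lam; field; rewrite gt_eqF.
have lam0 : 0 < lam by rewrite divr_gt0// divr_gt0.
have lam12 : lam <= 1 / 2.
  by rewrite /lam ler_pM2r ?invr_gt0// ler_pdivrMr// mul1r.
clearbody lam x y.
(* The two tails are the cases [e = 1] and [e = -1]. *)
have h (e : R) : e ^+ 2 = 1 -> e <= 1 ->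
    fails_with_pr P (expR (- l)) (fun w => e * deviation B w <= 4 * (x * y)).
  move=> e2 e1; have elam : e * lam <= 1 / 2 by nra.
  apply: fails_with_pr_mono (chernoff (3 / 2 * l) mB elam) => [|w].
    rewrite ler_expR exprMn e2 mul1r.
    have : n%:R * pr mu B * lam ^+ 2 <= (lam * x) ^+ 2.
      rewrite exprMn xx [leRHS]mulrC ler_wpM2r ?sqr_ge0//.
      by rewrite ler_wpM2l.
    rewrite lamx expr_div_n yy; lra.
  set D := deviation _ _ => hD.
  have {}hD : lam * (e * D) <= lam * (4 * (x * y)).
    rewrite (_ : lam * (4 * (x * y)) = 4 * (lam * x) * y); last by ring.
    by rewrite lamx; nra.
  by rewrite ler_pM2l in hD.
have h1 : fails_with_pr P (expR (- l)) (fun w => 1 * deviation B w <= 4 * (x * y)).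
  by apply: h; rewrite ?expr1n.
have h2 : fails_with_pr P (expR (- l)) (fun w => - 1 * deviation B w <= 4 * (x * y)).
  by apply: h; [rewrite sqrrN expr1n|lra].
apply: fails_with_pr_mono (fails_with_pr_and h1 h2) => [|w [w1 w2]]; first by lra.
by rewrite ler_norml; apply/andP; split; lra.
Qed.

Lemma count_setD A B w : B `<=` A -> count (A `\` B) w = count A w - count B w.
Proof.
move=> BA; rewrite /count -sumrB; apply: eq_bigr => i _.
have := BA (X i w); move: (X i w) => y yBA.
have -> : `[< (A `\` B) y >] = `[< A y >] && ~~ `[< B y >].
  by rewrite -asbool_neg -asbool_and.
case: (asboolP (B y)) => hB; last by rewrite andbT subr0.
by rewrite (asboolT (yBA hB)) subrr.
Qed.

Lemma deviation_setD A B w : measurable A -> measurable B -> B `<=` A ->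
  deviation (A `\` B) w = deviation A w - deviation B w.
Proof.
by move=> mA mB BA; rewrite /deviation count_setD// prD//; ring.
Qed.

Lemma le_count A B w : A `<=` B -> count A w <= count B w.
Proof.
move=> AB; apply: ler_sum => i _; case: asboolP => [/AB h|_].
  by rewrite asboolT.
by case: asboolP.
Qed.

Lemma deviationT w : deviation setT w = 0.
Proof.
rewrite /deviation prT mulr1 /count (eq_bigr (fun=> 1)).
  by rewrite sumr_const card_ord subrr.
by move=> i _; rewrite asboolT.
Qed.

End concentration.

(** * Lipschitz property of joint distributions with uniform margins *)

Section increasing_events.
Context {R : realType} {d : nat} {disp : measure_display}
  {T : measurableType disp} (P : probability T R) (E : 'I_d -> R -> set T).
Implicit Types (u v : 'rV[R]_d) (s t : R).
Hypothesis mE : forall j t, measurable (E j t).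
Hypothesis prE_unif : forall j t, 0 <= t <= 1 -> pr P (E j t) = t.
Hypothesis E_nd : forall j s t, s <= t -> E j s `<=` E j t.

Definition meet_events (u : 'rV[R]_d) : set T := [set y | forall j, E j (u 0 j) y].

Lemma measurable_meet_events u : measurable (meet_events u).
Proof.
rewrite (_ : meet_events u = \bigcap_(j in [set: 'I_d]) E j (u 0 j)).
  by apply: fin_bigcap_measurable => // j _; exact: mE.
by apply/seteqP; split => [y h j _|y h j]; [exact: h|exact: (h j)].
Qed.

Lemma le_meet_events u v : (forall j, u 0 j <= v 0 j) ->
  meet_events u `<=` meet_events v.
Proof. by move=> uv y h j; exact: E_nd (h j). Qed.

(** The difference of the two events is covered by the strips [E j (v 0 j)] minus [E j (u 0 j)], of
    mass [v 0 j - u 0 j]. *)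
Lemma pr_meet_events_increment u v : unit_cube u -> unit_cube v ->
  (forall j, u 0 j <= v 0 j) ->
  pr P (meet_events v) - pr P (meet_events u) <= \sum_j (v 0 j - u 0 j).
Proof.
move=> cu cv uv; rewrite lerBlDl.
have mD j : measurable (E j (v 0 j) `\` E j (u 0 j)) by exact: measurableD.
apply: (@le_trans _ _ (pr P (meet_events u `|`
    \big[setU/set0]_j (E j (v 0 j) `\` E j (u 0 j))))).
  apply: le_pr; first exact: measurable_meet_events.
    apply: measurableU; first exact: measurable_meet_events.
    exact: bigsetU_measurable.
  move=> y hv; case: (pselect (meet_events u y)) => hu; [by left|right].
  have [j hj] : exists j, ~ E j (u 0 j) y by apply/existsNP.
  by rewrite -bigcup_seq; exists j; rewrite /= ?mem_index_enum//; split => //; exact: hv.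
apply: le_trans (prU _ _ _) _; first exact: measurable_meet_events.
  exact: bigsetU_measurable.
rewrite lerD2l; apply: le_trans (pr_bigU _ _ _ mD) _.
apply: ler_sum => j _; rewrite prD//; last exact: E_nd.
by rewrite !prE_unif.
Qed.

(** Incomparable points are compared through their componentwise minimum [m u v]. *)
Lemma pr_meet_events_lipschitz u v : unit_cube u -> unit_cube v ->
  `|pr P (meet_events v) - pr P (meet_events u)| <= \sum_j `|v 0 j - u 0 j|.
Proof.
pose m (u v : 'rV[R]_d) : 'rV[R]_d := \row_j Num.min (u 0 j) (v 0 j).
have h (u' v' : 'rV[R]_d) : unit_cube u' -> unit_cube v' ->
    pr P (meet_events v') - pr P (meet_events u') <= \sum_j `|v' 0 j - u' 0 j|.
  move=> cu cv.
  have cm : unit_cube (m u' v').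
    by move=> j; rewrite mxE /Num.min; case: ifP.
  have mu j : m u' v' 0 j <= u' 0 j by rewrite mxE ge_min lexx.
  have mv j : m u' v' 0 j <= v' 0 j by rewrite mxE ge_min lexx orbT.
  have := pr_meet_events_increment cm cv mv.
  have := le_pr P (measurable_meet_events _) (measurable_meet_events _)
    (le_meet_events mu).
  suff : \sum_j (v' 0 j - m u' v' 0 j) <= \sum_j `|v' 0 j - u' 0 j| by lra.
  apply: ler_sum => j _; rewrite mxE /Num.min; case: ltP => uv; first exact: ler_norm.
  by rewrite subrr normr_ge0.
move=> cu cv; rewrite ler_norml; apply/andP; split; last exact: h.
rewrite lerNl opprB; apply: le_trans (h _ _ cv cu) _.
by apply: ler_sum => j _; rewrite distrC.
Qed.

End increasing_events.

(** * The probability integral transform and the copula as the law of the transformed vector *)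

Section uniformized_margins.
Context {R : realType} {d : nat} (mu : probability (d.-tuple R) R).
Implicit Types (u v : 'rV[R]_d) (s t x : R).
Local Notation F := (marginal_cdf mu).
Hypothesis cF : forall j, continuous (F j).

Lemma measurable_tnth_le (j : 'I_d) x :
  measurable [set y : d.-tuple R | tnth y j <= x].
Proof.
rewrite (_ : [set _ | _] = [set: d.-tuple R] `&` (@tnth d R ^~ j) @^-1` `]-oo, x]%classic).
  exact: measurable_tnth.
by rewrite setTI; apply/seteqP; split=> y /=; rewrite in_itv.
Qed.

Lemma marginal_cdf_nd j : {homo F j : x y / x <= y}.
Proof.
move=> x y xy; apply: le_pr; try exact: measurable_tnth_le.
by move=> z /= /le_trans; apply.
Qed.

Lemma marginal_cdf_ge0 j x : 0 <= F j x.
Proof. exact: pr_ge0. Qed.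

Lemma marginal_cdf_le1 j x : F j x <= 1.
Proof. by apply: pr_le1; exact: measurable_tnth_le. Qed.

(** Intermediate value theorem between the limits at the two infinities. The values 0 and 1 are
    excluded because a continuous cdf need not attain them. *)
Lemma marginal_cdf_onto j t : 0 < t < 1 -> exists x, F j x = t.
Proof.
move=> /andP[t0 t1].
pose T : d.-tuple R -> R := @tnth d R ^~ j.
have mT : measurable_fun setT T by exact: measurable_tnth.
(* The coordinate is packed as a real random variable so that the known limits of [cdf] apply to
   [F j]. *)
pose TM := isMeasurableFun.Build _ _ _ _ T mT.
pose TRV : {RV mu >-> R} := HB.pack T TM.
have FE x : F j x = fine (cdf TRV x).
  rewrite /marginal_cdf (_ : [set y | _] = T @^-1` `]-oo, x]%classic)//.
have [a Fa] : exists a, F j a < t.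
  have : F j @ -oo --> (0:R).
    by rewrite (funext FE); apply/fine_cvg/cvg_cdfNy0.
  move=> /cvgr_lt/(_ _ t0) [a [_ ha]]; exists (a - 1); apply: ha; lra.
have [b Fb] : exists b, t < F j b.
  have : F j @ +oo --> (1:R).
    by rewrite (funext FE); apply/fine_cvg/cvg_cdfy1.
  move=> /cvgr_gt/(_ _ t1) [b [_ hb]]; exists (b + 1); apply: hb; lra.
have ab : a <= b.
  rewrite leNgt; apply/negP => /ltW/(marginal_cdf_nd j) h.
  by have := lt_trans Fa (lt_le_trans Fb h); rewrite ltxx.
have [|c _ <-] := @IVT R (F j) a b t ab (continuous_subspaceT (cF (j := j))).
  by rewrite ge_min le_max (ltW Fa) (ltW Fb) orbT.
by exists c.
Qed.

Definition unif_le (j : 'I_d) (t : R) : set (d.-tuple R) :=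
  [set y | F j (tnth y j) <= t].

Lemma measurable_unif_le j t : measurable (unif_le j t).
Proof.
have mf : measurable_fun setT (F j \o @tnth d R ^~ j).
  apply: measurableT_comp; last exact: measurable_tnth.
  exact: (nondecreasing_measurable measurableT (@marginal_cdf_nd j)).
rewrite (_ : unif_le j t = setT `&` (F j \o @tnth d R ^~ j) @^-1` `]-oo, t]%classic).
  exact: mf.
by rewrite setTI; apply/seteqP; split=> y /=; rewrite in_itv.
Qed.

Lemma unif_le_nd j s t : s <= t -> unif_le j s `<=` unif_le j t.
Proof. by move=> st y /= /le_trans; apply. Qed.

(** If [F j x = t], the half-line below [x] lies in the event, which gives the lower bound. If
    [F j x = s > t], it contains the event, which gives the upper bound as [s] decreases to [t]. *)
Lemma pr_unif_le j t : 0 <= t <= 1 -> pr mu (unif_le j t) = t.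
Proof.
move=> /andP[t0 t1]; apply/le_anti/andP; split.
  have [->|t1'] := eqVneq t 1; first by apply: pr_le1; exact: measurable_unif_le.
  have {}t1 : t < 1 by rewrite lt_neqAle t1'.
  apply/ler_addgt0Pl => e e0.
  (* Strictly between [t] and 1, so that [s] is attained by [F j]. *)
  pose s := Num.min (t + e) ((t + 1) / 2).
  have ts : t < s by rewrite lt_min; apply/andP; split; lra.
  have s1 : s < 1 by rewrite gt_min; apply/orP; right; lra.
  have se : s <= e + t by rewrite addrC ge_min lexx.
  have [|x Fx] := @marginal_cdf_onto j s; first by rewrite s1 andbT (le_lt_trans t0).
  apply: le_trans se; rewrite -[leRHS]Fx.
  apply: le_pr; [exact: measurable_unif_le|exact: measurable_tnth_le|].
  move=> y /= yt; rewrite leNgt; apply/negP => /ltW/(marginal_cdf_nd j).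
  by rewrite Fx => /(lt_le_trans ts)/lt_le_trans/(_ yt); rewrite ltxx.
have [->|t0'] := eqVneq t 0; first exact: pr_ge0.
have [->|t1'] := eqVneq t 1.
  rewrite (_ : unif_le j 1 = setT) ?prT//.
  by apply/seteqP; split=> // y _; exact: marginal_cdf_le1.
have [|x Fx] := @marginal_cdf_onto j t; first by rewrite !lt_neqAle eq_sym t0' t0 t1' t1.
rewrite -[leLHS]Fx; apply: le_pr; [exact: measurable_tnth_le|exact: measurable_unif_le|].
by move=> y /= /(marginal_cdf_nd j); rewrite Fx.
Qed.

Definition orthant : 'rV[R]_d -> set (d.-tuple R) := meet_events unif_le.

Variable C : 'rV[R]_d -> R.
Hypothesis CC : copula_of C mu.

(** Taken under the law [nu] defining the copula: the identification of [C] under [mu] relies on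
    this bound. *)
Lemma copula_lipschitz u v : unit_cube u -> unit_cube v ->
  `|C v - C u| <= \sum_j `|v 0 j - u 0 j|.
Proof.
have [[nu [nu_unif Cnu]] _] := CC.
move=> cu cv; rewrite !Cnu//.
apply: (@pr_meet_events_lipschitz _ _ _ _ nu
  (fun j t => [set y : d.-tuple R | tnth y j <= t])) => //.
- by move=> j t; exact: measurable_tnth_le.
- by move=> j s t st y /= /le_trans; apply.
Qed.

(** At an interior point Sklar's identity is used at [x] with [F j (x 0 j) = u 0 j]. Where [F j] is
    flat the event [F j (y j) <= u 0 j] is larger than [y j <= x 0 j], but both have mass [u 0 j],
    so the excess is null. Boundary points follow by approximation, both sides being Lipschitz. *)
Lemma copula_uniformized u : unit_cube u -> C u = pr mu (orthant u).
Proof.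
have step v : (forall j, 0 < v 0 j < 1) -> C v = pr mu (orthant v).
  move=> hv; have [_ sklar] := CC.
  pose x : 'rV[R]_d := \row_j xget 0 [set x | F j x = v 0 j].
  have Fx j : F j (x 0 j) = v 0 j.
    by rewrite mxE; case: xgetP => // h; have [y /h] := @marginal_cdf_onto j _ (hv j).
  have -> : v = \row_j F j (x 0 j).
    by apply/rowP => j; rewrite mxE Fx.
  rewrite -sklar; set v' := \row_j _.
  have v'E j : v' 0 j = F j (x 0 j) by rewrite mxE.
  have mJ : measurable [set y : d.-tuple R | forall j, tnth y j <= x 0 j].
    apply: (@measurable_meet_events _ _ _ _
      (fun j t => [set y : d.-tuple R | tnth y j <= t])).
    by move=> j t; exact: measurable_tnth_le.
  have mO : measurable (orthant v').
    by apply: measurable_meet_events; exact: measurable_unif_le.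
  have mD j : measurable (unif_le j (v' 0 j) `\` [set y | tnth y j <= x 0 j]).
    by apply: measurableD; [exact: measurable_unif_le|exact: measurable_tnth_le].
  have sub : [set y : d.-tuple R | forall j, tnth y j <= x 0 j] `<=` orthant v'.
    by move=> y h j; rewrite /unif_le/= v'E; exact: marginal_cdf_nd.
  apply/le_anti/andP; split; first exact: le_pr.
  rewrite -[leRHS]addr0.
  apply: (@le_trans _ _ (pr mu ([set y | forall j, tnth y j <= x 0 j] `|`
      \big[setU/set0]_j (unif_le j (v' 0 j) `\` [set y | tnth y j <= x 0 j])))).
    apply: le_pr => //.
      by apply: measurableU => //; exact: bigsetU_measurable.
    move=> y h; case: (pselect (forall j, tnth y j <= x 0 j)) => hx; [by left|right].
    have [j hj] : exists j, ~ (tnth y j <= x 0 j) by apply/existsNP.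
    by rewrite -bigcup_seq; exists j; rewrite /= ?mem_index_enum//; split => //; exact: h.
  apply: le_trans (prU _ _ _) _ => //; first exact: bigsetU_measurable.
  rewrite lerD2l; apply: le_trans (pr_bigU _ _ _ mD) _.
  rewrite big1// => j _; rewrite prD//.
  - by rewrite pr_unif_le v'E ?subrr// marginal_cdf_ge0 marginal_cdf_le1.
  - exact: measurable_unif_le.
  - exact: measurable_tnth_le.
  - by move=> y /= h; rewrite /unif_le /= v'E; exact: marginal_cdf_nd.
move=> cu.
apply/eqP; rewrite -subr_eq0 -normr_le0; apply/ler_addgt0Pl => e e0.
rewrite addr0.
pose h : R := Num.min (e / (2 * d.+1%:R)) (1 / 4).
have h0 : 0 < h.
  by rewrite lt_min; apply/andP; split; [rewrite divr_gt0// mulr_gt0// ltr0n|lra].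
have h4 : h <= 1 / 4 by rewrite ge_min lexx orbT.
(* A contraction towards the centre of the cube. Each coordinate moves by at most
   [h <= e / (2 (d + 1))], so each side changes by at most [e / 2]. *)
pose v : 'rV[R]_d := \row_j (u 0 j * (1 - 2 * h) + h).
have vE j : v 0 j = u 0 j * (1 - 2 * h) + h by rewrite mxE.
have hv j : 0 < v 0 j < 1.
  by rewrite vE; have := cu j; move=> /andP[u0 u1]; apply/andP; split; nra.
have cv : unit_cube v by move=> j; have /andP[/ltW -> /ltW ->] := hv j.
have uv : \sum_j `|u 0 j - v 0 j| <= e / 2.
  apply: (@le_trans _ _ (\sum_(j < d) h)).
    apply: ler_sum => j _; rewrite vE ler_norml; have /andP[u0 u1] := cu j.
    by apply/andP; split; nra.
  rewrite sumr_const card_ord -mulr_natl.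
  have : h * (2 * d.+1%:R) <= e.
    by rewrite -ler_pdivlMr ?mulr_gt0 ?ltr0n// ge_min lexx.
  have : (d%:R : R) <= d.+1%:R by rewrite ler_nat.
  nra.
have h1 := copula_lipschitz cv cu.
have h2 := pr_meet_events_lipschitz measurable_unif_le pr_unif_le unif_le_nd cv cu.
have h3 := step v hv.
rewrite (_ : C u - pr mu (orthant u) = (C u - C v) -
   (pr mu (orthant u) - pr mu (orthant v))); last by rewrite h3; ring.
apply: le_trans (ler_normB _ _) _; rewrite /orthant in h2 *; lra.
Qed.

Lemma measurable_orthant u : measurable (orthant u).
Proof. exact: (measurable_meet_events measurable_unif_le). Qed.

Lemma le_orthant u v : (forall j, u 0 j <= v 0 j) -> orthant u `<=` orthant v.
Proof. exact: (le_meet_events unif_le_nd). Qed.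

Lemma pr_orthant_increment u v : unit_cube u -> unit_cube v ->
  (forall j, u 0 j <= v 0 j) ->
  pr mu (orthant v) - pr mu (orthant u) <= \sum_j (v 0 j - u 0 j).
Proof.
exact: (pr_meet_events_increment measurable_unif_le pr_unif_le unif_le_nd).
Qed.

End uniformized_margins.

(** * Grids of mesh [1 / n] on the faces of dimension at most [k] *)

Section grid_points.
Context {R : realType} {d : nat}.
Implicit Types (k n : nat) (u v : 'rV[R]_d).

(** The map [f] lists the coordinates allowed to differ from 1. It may repeat a coordinate, in which
    case [pick] selects one index; thus [d^k] maps cover all faces of dimension at most [k]. *)
Definition grid_point k n (f : {ffun 'I_k -> 'I_d}) (g : {ffun 'I_k -> 'I_n.+1})
    : 'rV[R]_d :=
  \row_j (if [pick i | f i == j] is Some i then (g i)%:R / n%:R else 1).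

Definition grid_down k n (f : {ffun 'I_k -> 'I_d}) u : 'rV[R]_d :=
  grid_point f [ffun i => inord (Num.truncn (n%:R * u 0 (f i))) : 'I_n.+1].

(** The cap [minn n] keeps the index in range when [u 0 (f i) = 1]. *)
Definition grid_up k n (f : {ffun 'I_k -> 'I_d}) u : 'rV[R]_d :=
  grid_point f
    [ffun i => inord (minn n (Num.truncn (n%:R * u 0 (f i))).+1) : 'I_n.+1].

Lemma grid_point_cube k n f (g : {ffun 'I_k -> 'I_n.+1}) :
  unit_cube (grid_point f g).
Proof.
move=> j; rewrite mxE; case: pickP => [i _|_]; last by rewrite ler01 lexx.
rewrite divr_ge0//=; case: n g => [|n] g; first by rewrite invr0 mulr0 ler01.
by rewrite ler_pdivrMr ?ltr0n// mul1r ler_nat -ltnS.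
Qed.

Lemma gridP k n (f : {ffun 'I_k -> 'I_d}) u : (0 < n)%N -> unit_cube u ->
  (forall j, u 0 j < 1 -> j \in codom f) ->
  forall j, [/\ grid_down n f u 0 j <= u 0 j, u 0 j <= grid_up n f u 0 j,
    grid_up n f u 0 j <= grid_down n f u 0 j + (j \in codom f)%:R / n%:R &
    u 0 j - (j \in codom f)%:R / n%:R <= grid_down n f u 0 j].
Proof.
move=> n0 cu hf j; have /andP[u0 u1] := cu j.
have n0' : 0 < n%:R :> R by rewrite ltr0n.
rewrite !mxE; case: pickP => [i /eqP fi|nof]; last first.
  have jf : j \notin codom f.
    by apply/negP => /codomP[i fi]; have := nof i; rewrite fi eqxx.
  have -> : u 0 j = 1.
    by apply/eqP; rewrite eq_le u1 leNgt; apply: contra jf; exact: hf.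
  by rewrite (negbTE jf) mul0r addr0 subr0 lexx; split.
have -> : j \in codom f by rewrite -fi codom_f.
rewrite !ffunE fi; set m := Num.truncn _.
have nu0 : 0 <= n%:R * u 0 j by rewrite mulr_ge0.
have nun : n%:R * u 0 j <= n%:R by rewrite ler_piMr.
have m1 : m%:R <= n%:R * u 0 j by rewrite truncn_le.
have m2 : n%:R * u 0 j < m.+1%:R by exact: truncnS_gt.
have mn : (m <= n)%N by rewrite -(@ler_nat R); exact: le_trans nun.
rewrite !inordK ?ltnS ?geq_minl//.
have eq : n%:R * u 0 j = u 0 j * n%:R by rewrite mulrC.
have mS : (m.+1%:R : R) = m%:R + 1 by rewrite natr1.
have e1 : m%:R / n%:R * n%:R = m%:R :> R by rewrite divfK ?gt_eqF.
have e2 : 1 / n%:R * n%:R = 1 :> R by rewrite divfK ?gt_eqF.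
have e3 : (minn n m.+1)%:R / n%:R * n%:R = (minn n m.+1)%:R :> R.
  by rewrite divfK ?gt_eqF.
have h1 : n%:R * u 0 j <= (minn n m.+1)%:R.
  by rewrite /minn; case: ltnP => _ //; exact: ltW.
have h2 : ((minn n m.+1)%:R : R) <= m%:R + 1.
  by rewrite -mS ler_nat geq_minr.
split; rewrite -(ler_pM2r n0') ?mulrDl ?mulNr ?e1 ?e2 ?e3; lra.
Qed.

Lemma grid_down_nd k n (f : {ffun 'I_k -> 'I_d}) u v : (0 < n)%N ->
  unit_cube u -> unit_cube v ->
  (forall j, u 0 j <= v 0 j) ->
  forall j, grid_down n f u 0 j <= grid_down n f v 0 j.
Proof.
move=> n0 cu cv uv j; rewrite !mxE; case: pickP => // i _; rewrite !ffunE.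
have n0' : 0 < n%:R :> R by rewrite ltr0n.
have h (x : 'rV[R]_d) : unit_cube x -> (Num.truncn (n%:R * x 0 (f i))%R < n.+1)%N.
  move=> cx; have /andP[x0 x1] := cx (f i).
  rewrite ltnS -(@ler_nat R); apply: (@le_trans _ _ (n%:R * x 0 (f i))).
    by rewrite truncn_le mulr_ge0// ltW.
  by rewrite ler_piMr// ltW.
rewrite !inordK ?h// ler_pM2r ?invr_gt0// ler_nat.
by apply: le_truncn; rewrite ler_pM2l.
Qed.

Lemma sum_codom_le k (f : {ffun 'I_k -> 'I_d}) (c : R) : 0 <= c ->
  \sum_j (j \in codom f)%:R * c <= k%:R * c.
Proof.
move=> c0; rewrite -mulr_suml ler_wpM2r// -natr_sum ler_nat.
rewrite (eq_bigr (fun j => if j \in codom f then 1 else 0)%N); last first.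
  by move=> j _; case: (_ \in _).
rewrite -big_mkcond sum1_card -[X in (_ <= X)%N]card_ord.
exact: leq_image_card.
Qed.

Lemma W_codom k u : (0 < d)%N -> W k u ->
  exists f : {ffun 'I_k -> 'I_d}, forall j, u 0 j < 1 -> j \in codom f.
Proof.
move=> d0 [_]; set J := [pred j | _] => Jk.
(* If fewer than [k] coordinates are below 1, the list is padded with coordinate 0. *)
exists [ffun i : 'I_k => nth (Ordinal d0) (enum J) i] => j uj.
have jJ : j \in enum J by rewrite mem_enum inE.
have ik : (index j (enum J) < k)%N by rewrite (leq_trans _ Jk)// cardE index_mem.
apply/codomP; exists (Ordinal ik).
by rewrite ffunE/= nth_index.
Qed.

End grid_points.

(** * Oscillations of the empirical process on [W k] *)

Section oscillation.
Context {R : realType} {d : nat} {disp : measure_display}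
  {Omega : measurableType disp} (P : probability Omega R) {n : nat}
  (X : 'I_n -> {RV P >-> d.-tuple R}) (mu : probability (d.-tuple R) R).
Hypothesis iid : iid_sample X mu.
Hypothesis cF : forall j, continuous (marginal_cdf mu j).
Hypothesis n0 : (0 < n)%N.

Definition dev (u : 'rV[R]_d) (w : Omega) : R := deviation X mu (orthant mu u) w.

Lemma dev_sandwich u v (e : R) w : unit_cube u -> unit_cube v ->
  (forall j, u 0 j <= v 0 j) -> \sum_j (v 0 j - u 0 j) <= e ->
  dev u w <= dev v w + n%:R * e.
Proof.
move=> cu cv uv uve; rewrite /dev /deviation.
have h1 := le_count X w (le_orthant (mu := mu) uv).
have h2 := pr_orthant_increment cF cu cv uv.
have h3 : n%:R * (pr mu (orthant mu v) - pr mu (orthant mu u)) <= n%:R * e.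
  by rewrite ler_wpM2l//; exact: le_trans uve.
lra.
Qed.

(** Adding [a] to the bound on the mass secures the condition [l <= n q] of [bernstein] even for
    close points. *)
Lemma grid_bernstein u v (a l : R) : unit_cube u -> unit_cube v ->
  (forall j, u 0 j <= v 0 j) -> 0 < l -> l <= n%:R * a ->
  fails_with_pr P (2 * expR (- l)) (fun w =>
    `|dev v w - dev u w| <= 4 * Num.sqrt (n%:R * (\sum_j (v 0 j - u 0 j) + a) * l)).
Proof.
move=> cu cv uv l0 la.
have mO := measurable_orthant mu.
have s0 : 0 <= \sum_j (v 0 j - u 0 j) by apply: sumr_ge0 => j _; rewrite subr_ge0.
have a0 : 0 <= a.
  by rewrite -(pmulr_rge0 _ (_ : 0 < n%:R)) ?ltr0n// (le_trans (ltW l0)).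
apply: fails_with_pr_mono (bernstein (B := orthant mu v `\` orthant mu u)
  (q := \sum_j (v 0 j - u 0 j) + a) iid _ _ l0 _) => // [w|||].
- by rewrite deviation_setD//; exact: le_orthant.
- exact: measurableD.
- rewrite prD//; last exact: le_orthant.
  by have := pr_orthant_increment cF cu cv uv; lra.
- by apply: le_trans la _; rewrite ler_wpM2l// lerDr.
Qed.

Definition grid_event k (a l : R) (w : Omega) : Prop :=
  forall (f : {ffun 'I_k -> 'I_d}) (g h : {ffun 'I_k -> 'I_n.+1}),
    (forall j, grid_point (R := R) f g 0 j <= grid_point f h 0 j) ->
    `|dev (grid_point f h) w - dev (grid_point f g) w| <=
    4 * Num.sqrt (n%:R * (\sum_j (grid_point f h 0 j - grid_point f g 0 j) + a) * l).

(** Union bound over [d^k] maps [f] and [(n + 1)^(2 k)] pairs of grid points; for incomparable pairs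
    there is nothing to show. *)
Lemma grid_event_pr k (a l delta : R) : 0 < l -> l <= n%:R * a ->
  (n.+1%:R ^+ k) ^+ 2 * (2 * expR (- l)) <= delta ->
  fails_with_pr P (d%:R ^+ k * delta) (grid_event k a l).
Proof.
move=> l0 la ld.
pose I := ({ffun 'I_k -> 'I_d} * ({ffun 'I_k -> 'I_n.+1} * {ffun 'I_k -> 'I_n.+1}))%type.
pose Q (i : I) (w : Omega) : Prop := let: (f, (g, h)) := i in
    (forall j, grid_point (R := R) f g 0 j <= grid_point f h 0 j) ->
    `|dev (grid_point f h) w - dev (grid_point f g) w| <=
    4 * Num.sqrt (n%:R * (\sum_j (grid_point f h 0 j - grid_point f g 0 j) + a) * l).
have hQ i : fails_with_pr P (2 * expR (- l)) (Q i).
  case: i => f [g h]; rewrite /Q.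
  case: (pselect (forall j, grid_point (R := R) f g 0 j <= grid_point f h 0 j)) => gh.
    apply: fails_with_pr_mono (grid_bernstein _ _ gh l0 la) => //; exact: grid_point_cube.
  apply: fails_with_pr_mono (fails_with_pr_true P _) => //.
apply: fails_with_pr_mono (fails_with_pr_all_const hQ) => [|w hw f g h]; last first.
  exact: (hw (f, (g, h))).
rewrite !card_prod !card_ffun !card_ord !natrM !natrX -mulrA ler_wpM2l ?exprn_ge0//.
Qed.

(** With [S] the root in the conclusion, [14 = 5 + 4 + 5]: rounding each of [u] and [v] down costs
    [5 S], the grid increment [4 S]. In [2 a], one [a] comes from [grid_event] and the other absorbs
    the rounding [k / n]. The same [f] serves both points, since [v 0 j < 1] forces [u 0 j < 1]. *)
Lemma dev_osc k (a l e : R) w u v : (0 < d)%N -> grid_event k a l w ->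
  0 < l -> l <= n%:R * a -> k%:R <= l ->
  W k u -> unit_cube v -> 0 <= e ->
  (forall j, u 0 j <= v 0 j) -> (forall j, v 0 j <= u 0 j + e) ->
  `|dev v w - dev u w| <= 14 * Num.sqrt (n%:R * (k%:R * e + 2 * a) * l).
Proof.
move=> d0 hw l0 la kl Wu cv e0 uv uve.
have [f hfu] := W_codom d0 Wu; have [cu _] := Wu.
have hfv j : v 0 j < 1 -> j \in codom f.
  by move=> vj; apply: hfu; exact: le_lt_trans vj.
have n0' : 0 < n%:R :> R by rewrite ltr0n.
have kn : k%:R / n%:R <= a by rewrite ler_pdivrMr//; lra.
have k0 : 0 <= k%:R :> R by [].
have ke0 : 0 <= k%:R * e by rewrite mulr_ge0.
have a0 : 0 <= a by apply: le_trans kn; rewrite divr_ge0.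
set S := Num.sqrt (n%:R * (k%:R * e + 2 * a) * l).
have kS : k%:R <= S.
  rewrite -[leLHS]ger0_norm// -sqrtr_sqr ler_wsqrtr// expr2.
  have : n%:R * a * l <= n%:R * (k%:R * e + 2 * a) * l.
    by rewrite ler_pM2r// ler_pM2l//; lra.
  have : k%:R * k%:R <= l * l by apply: ler_pM.
  nra.
have bS q : q <= k%:R * e + 2 * a -> 4 * Num.sqrt (n%:R * q * l) <= 4 * S.
  move=> h; rewrite ler_pM2l//; apply: ler_wsqrtr.
  by rewrite ler_pM2r// ler_pM2l.
(* A grid cell has mass at most [k / n], that is at most [k <= S] expected points, and the increment
   across it is at most [4 S]. *)
have close x : unit_cube x -> (forall j, x 0 j < 1 -> j \in codom f) ->
    `|dev x w - dev (grid_down n f x) w| <= 5 * S.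
  move=> cx hx; have G := gridP n0 cx hx.
  have du j : grid_down n f x 0 j <= grid_up n f x 0 j.
    by have [g1 g2 _ _] := G j; exact: le_trans g2.
  have hs : \sum_j (grid_up n f x 0 j - grid_down n f x 0 j) <= k%:R / n%:R.
    apply: le_trans (sum_codom_le f (c := n%:R^-1) _); last by rewrite invr_ge0.
    by apply: ler_sum => j _; have [_ _ g3 _] := G j; lra.
  have h1 : dev x w <= dev (grid_up n f x) w + n%:R * (k%:R / n%:R).
    apply: dev_sandwich => //; first exact: grid_point_cube.
      by move=> j; have [_ g2 _ _] := G j.
    by apply: le_trans hs; apply: ler_sum => j _; have [g1 _ _ _] := G j; lra.
  have h2 : dev (grid_down n f x) w <= dev x w + n%:R * (k%:R / n%:R).
    apply: dev_sandwich => //; first exact: grid_point_cube.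
      by move=> j; have [g1 _ _ _] := G j.
    by apply: le_trans hs; apply: ler_sum => j _; have [_ g2 _ _] := G j; lra.
  have h3 := hw f _ _ du.
  have h4 := le_trans h3 (bS _ _).
  rewrite mulrC divfK ?gt_eqF// in h1 h2.
  have {}h4 : `|dev (grid_up n f x) w - dev (grid_down n f x) w| <= 4 * S.
    by apply: h4; move: hs; rewrite /grid_up /grid_down; lra.
  move: h4; rewrite !ler_norml => /andP[h5 h6]; apply/andP; split; lra.
have cdu := close u cu hfu.
have cdv := close v cv hfv.
have := hw f _ _ (grid_down_nd f n0 cu cv uv).
move=> /le_trans/(_ (bS _ _)) cuv.
have {}cuv : `|dev (grid_down n f v) w - dev (grid_down n f u) w| <= 4 * S.
  apply: cuv; rewrite -/(grid_down n f v) -/(grid_down n f u).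
  apply: (@le_trans _ _ (\sum_j (j \in codom f)%:R * (e + n%:R^-1) + a)); last first.
    have ge0 : 0 <= e + n%:R^-1 by rewrite addr_ge0// invr_ge0.
    by have := sum_codom_le f ge0; rewrite mulrDr; lra.
  rewrite lerD2r; apply: ler_sum => j _.
  have [g1 _ _ _] := gridP n0 cv hfv j.
  have [_ _ _ g4] := gridP n0 cu hfu j.
  case jf: (j \in codom f) g4 => g4 ; last first.
    have [_ _ _ g4'] := gridP n0 cv hfv j.
    have vj : v 0 j = u 0 j.
      apply/le_anti; rewrite uv andbT.
      apply: le_trans (_ : 1 <= _); first by have /andP[] := cv j.
      by rewrite leNgt; apply/negP => /hfu; rewrite jf.
    by move: g4; rewrite !mulr0n !mul0r; lra.
  have := uve j; move: g4; rewrite !mulr1n !mul1r.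
  lra.
move: cdu cdv cuv; rewrite !ler_norml => /andP[? ?] /andP[? ?] /andP[? ?].
apply/andP; split; lra.
Qed.

End oscillation.

(** * Uniform bound on the marginal processes by dyadic chaining *)

Section dyadic_chaining.
Context {R : realType} {d : nat} {disp : measure_display}
  {Omega : measurableType disp} (P : probability Omega R) {n : nat}
  (X : 'I_n -> {RV P >-> d.-tuple R}) (mu : probability (d.-tuple R) R).
Hypothesis iid : iid_sample X mu.
Hypothesis cF : forall j, continuous (marginal_cdf mu j).
Hypothesis n0 : (0 < n)%N.
Implicit Types (j : 'I_d) (s t D : R) (w : Omega).

Definition margin_dev j t w : R := deviation X mu (unif_le mu j t) w.

Lemma margin_dev_sandwich j s t w : 0 <= s -> s <= t -> t <= 1 ->
  margin_dev j s w <= margin_dev j t w + n%:R * (t - s).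
Proof.
move=> s0 st t1; rewrite /margin_dev /deviation.
rewrite !pr_unif_le//; try by apply/andP; split; lra.
have := le_count X w (@unif_le_nd _ _ mu j _ _ st); lra.
Qed.

Lemma margin_dev1 j w : margin_dev j 1 w = 0.
Proof.
rewrite /margin_dev (_ : unif_le mu j 1 = setT) ?deviationT//.
by apply/seteqP; split=> // y _; exact: marginal_cdf_le1.
Qed.

(** At level [m = l + 1] the cells have mass [2^-m]. The ratio [3 / 4] exceeds the natural
    [sqrt (1 / 2)], which leaves room for the union over [2^m] cells, and is still summable. *)
Definition chain_event j D (M : nat) w : Prop :=
  forall (l : 'I_M) (i : 'I_(2 ^ l.+1)),
    `|margin_dev j (i.+1%:R / 2 ^+ l.+1) w - margin_dev j (i%:R / 2 ^+ l.+1) w|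
    <= 16 * Num.sqrt (n%:R * D) * (3 / 4) ^+ l.+1.

(** At level [m], [bernstein] is used with exponent [16 D (9 / 8)^m], because
    [(1 / 2) (9 / 8) = (3 / 4)^2]. The failures at level [m] add up to at most [expR (- D) 2^-m]. *)
Lemma chain_event_pr j D (M : nat) : 1 <= D -> 16 * D * 4 ^+ M <= n%:R ->
  fails_with_pr P (expR (- D)) (chain_event j D M).
Proof.
move=> D1 DM; have D0 : 0 <= D by lra.
have step (l : 'I_M) (i : 'I_(2 ^ l.+1)) :
    fails_with_pr P (2 * expR (- (16 * D * (9 / 8) ^+ l.+1)))
    (fun w => `|margin_dev j (i.+1%:R / 2 ^+ l.+1) w -
                margin_dev j (i%:R / 2 ^+ l.+1) w|
    <= 16 * Num.sqrt (n%:R * D) * (3 / 4) ^+ l.+1).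
  set m := l.+1; have p2 : 0 < 2 ^+ m :> R by rewrite exprn_gt0.
  have i0 : 0 <= i%:R / 2 ^+ m :> R by rewrite divr_ge0// ltW.
  have ii : i%:R / 2 ^+ m <= i.+1%:R / 2 ^+ m :> R.
    by rewrite ler_pM2r ?invr_gt0// ler_nat.
  have i1 : i.+1%:R / 2 ^+ m <= 1 :> R.
    by rewrite ler_pdivrMr// mul1r -natrX ler_nat.
  have l0 : 0 < 16 * D * (9 / 8) ^+ m by rewrite mulr_gt0// ?exprn_gt0//; lra.
  have ln : 16 * D * (9 / 8) ^+ m <= n%:R * 2^-1 ^+ m.
    rewrite exprVn ler_pdivlMr//.
    rewrite -(mulrA (16 * D)) -exprMn.
    apply: le_trans DM; rewrite ler_wpM2l//; first lra.
    apply: (@le_trans _ _ (4 ^+ m)); first by apply: lerXn2r; rewrite ?nnegrE; lra.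
    by apply: ler_weXn2l; [lra|exact: ltn_ord].
  apply: fails_with_pr_mono (bernstein (B := unif_le mu j (i.+1%:R / 2 ^+ m) `\`
    unif_le mu j (i%:R / 2 ^+ m)) (q := 2^-1 ^+ m) iid _ _ l0 ln) => // [w||].
  - rewrite deviation_setD//; try exact: measurable_unif_le; last exact: unif_le_nd.
    move=> /le_trans; apply.
    rewrite (_ : n%:R * _ * _ = n%:R * D * (4 * (3 / 4) ^+ m) ^+ 2).
      rewrite sqrtrM ?mulr_ge0// sqrtr_sqr ger0_norm; first lra.
      by rewrite mulr_ge0// exprn_ge0//; lra.
    have -> : (4 * (3 / 4) ^+ m) ^+ 2 = 16 * (2^-1 ^+ m * (9 / 8) ^+ m) :> R.
      rewrite -exprMn (_ : 2^-1 * (9 / 8) = (3 / 4) ^+ 2 :> R); last by field.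
      by rewrite -exprM mulnC exprM exprMn; ring.
    by ring.
  - by apply: measurableD; exact: measurable_unif_le.
  - rewrite prD; try exact: measurable_unif_le; last exact: unif_le_nd.
    rewrite !pr_unif_le//; try by apply/andP; split; lra.
    by rewrite -mulrBl -natr1 addrAC subrr add0r mul1r exprVn.
apply: fails_with_pr_mono (fails_with_pr_all
  (fun l => fails_with_pr_all_const (step l))) => //.
apply: (@le_trans _ _ (\sum_(l < M) expR (- D) * 2^-1 ^+ l.+1)).
  apply: ler_sum => l _; rewrite card_ord natrX; set m := l.+1.
  (* By Bernoulli's inequality the exponent is at least [D + 1 + 2 m]; then [expR (- 1) <= 1 / 2]
     absorbs the factor 2 and [expR (- 2) <= 1 / 4] the number [2^m] of cells. *)
  have b : 1 + m%:R / 8 <= (9 / 8) ^+ m :> R.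
    rewrite (_ : 9 / 8 = 1 + 8^-1); last by field.
    elim: m => [|m IH]; first by rewrite expr0 mul0r addr0.
    rewrite exprS -natr1.
    have : 1 <= (1 + 8^-1) ^+ m :> R by rewrite exprn_ege1//; lra.
    lra.
  have mge0 : 0 <= m%:R :> R by [].
  have e2 : 2 <= expR 1 :> R.
    by have := expR_ge1Dx (1:R); lra.
  have c1 : expR (- (16 * D * (9 / 8) ^+ m)) <= expR (- D) * (expR (- 1) * expR (- 1 *+ 2) ^+ m).
    rewrite -expRM_natl -!expRD ler_expR.
    have : D * (15 + 2 * m%:R) >= 15 + 2 * m%:R by rewrite ler_peMl//; lra.
    have : D * (1 + m%:R / 8) <= D * (9 / 8) ^+ m by rewrite ler_wpM2l.
    lra.
  have e1 : expR (- 1) <= 2^-1 :> R.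
    by rewrite expRN lef_pV2// posrE// expR_gt0.
  have c2 : expR (- 1 *+ 2) ^+ m <= 4^-1 ^+ m :> R.
    apply: lerXn2r; rewrite ?nnegrE ?expR_ge0//.
    rewrite mulr2n expRD; have := expR_ge0 (- 1 : R); nra.
  have c3 : expR (- 1) * expR (- 1 *+ 2) ^+ m <= 2^-1 * 4^-1 ^+ m :> R.
    by apply: ler_pM; rewrite ?exprn_ge0 ?expR_ge0.
  have p2 : 0 < 2 ^+ m :> R by rewrite exprn_gt0.
  rewrite (_ : 2^-1 ^+ m = 2 ^+ m * 4^-1 ^+ m :> R); last first.
    by rewrite -exprMn; congr (_ ^+ _); field.
  rewrite [leRHS]mulrCA; apply: ler_wpM2l; first exact: ltW.
  have := ler_wpM2l (expR_ge0 (- D)) c3; lra.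
rewrite -mulr_sumr ler_piMr ?expR_ge0//.
suff -> : \sum_(l < M) 2^-1 ^+ l.+1 = 1 - 2^-1 ^+ M :> R.
  by rewrite lerBlDr lerDl exprn_ge0.
elim: (M) => [|m IH]; first by rewrite big_ord0 expr0 subrr.
by rewrite big_ord_recr /= IH exprS; field.
Qed.

(** [56 = 48 + 8]: 48 bounds the sum of [16 (3 / 4)^m] over [m >= 1], and 8 accounts for the mass of
    a finest cell around [t]. *)
Lemma chaining_bound j D (M : nat) w : 0 <= D -> margin_dev j 0 w = 0 ->
  chain_event j D M w -> n%:R <= 16 * D * 4 ^+ M.+1 ->
  forall t, 0 <= t <= 1 -> `|margin_dev j t w| <= 56 * Num.sqrt (n%:R * D).
Proof.
move=> D0 dev0 hw nM; set S := Num.sqrt _.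
have S0 : 0 <= S by rewrite sqrtr_ge0.
(* An even index names a point of the previous level; an odd one lies a single increment of its own
   level above an even one. *)
have dyadic m : (m <= M)%N -> forall i, (i <= 2 ^ m)%N ->
    `|margin_dev j (i%:R / 2 ^+ m) w| <= 48 * S * (1 - (3 / 4) ^+ m).
  elim: m => [|m IH] mM i im.
    rewrite expr0 divr1 subrr mulr0 normr_le0.
    by case: i im => [|[]]// _; rewrite ?dev0 ?margin_dev1.
  have even k : (k <= 2 ^ m)%N ->
      `|margin_dev j (k.*2%:R / 2 ^+ m.+1) w| <= 48 * S * (1 - (3 / 4) ^+ m).
    move=> km; rewrite -muln2 natrM exprSr -mulf_div divff// mulr1.
    exact: IH (ltnW mM) _ km.
  have q0 : 0 <= (3 / 4) ^+ m :> R by rewrite exprn_ge0//; lra.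
  have Sq : 0 <= S * (3 / 4) ^+ m by rewrite mulr_ge0.
  have im' : (i./2 <= 2 ^ m)%N.
    by rewrite leq_half_double (leq_trans im)// expnS mul2n.
  have := even _ im'; rewrite -[in X in _ -> X](odd_double_half i) (exprS (3 / 4)).
  case oi: (odd i); last by rewrite add0n; lra.
  rewrite add1n => he.
  have i2 : (i./2.*2 < 2 ^ m.+1)%N.
    by apply: leq_trans im; rewrite -[X in (_ < X)%N]odd_double_half oi.
  have := hw (Ordinal mM) (Ordinal i2); rewrite /= -/S => hi.
  move: he hi; rewrite (exprS (3 / 4)) !ler_norml => /andP[? ?] /andP[? ?].
  by apply/andP; split; lra.
(* From [n <= 64 D 4^M] one gets [(n / 2^M)^2 <= 64 n D]. *)
have slack : n%:R / 2 ^+ M <= 8 * S.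
  rewrite -[leLHS]ger0_norm ?divr_ge0 ?exprn_ge0// -sqrtr_sqr.
  rewrite -[X in X * S]ger0_norm// -sqrtr_sqr -sqrtrM ?sqr_ge0//.
  apply: ler_wsqrtr; rewrite exprMn exprVn -exprM mulnC exprM.
  rewrite (_ : 2 ^+ 2 = 4 :> R); last by rewrite expr2; lra.
  have p4 : 0 < 4 ^+ M :> R by rewrite exprn_gt0.
  rewrite ler_pdivrMr// !expr2.
  have := ler_wpM2l (ler0n R n) nM; rewrite exprS.
  by move=> h; apply: le_trans h _; rewrite le_eqVlt; apply/orP; left; apply/eqP; ring.
have dyadic' i : (i <= 2 ^ M)%N -> `|margin_dev j (i%:R / 2 ^+ M) w| <= 48 * S.
  move=> /(dyadic _ (leqnn M)) /le_trans; apply.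
  by rewrite ler_piMr ?mulr_ge0.
move=> t /andP[t0 t1].
have [->|tn1] := eqVneq t 1; first by rewrite margin_dev1 normr0 mulr_ge0.
have {}t1 : t < 1 by rewrite lt_neqAle tn1.
have p2 : 0 < 2 ^+ M :> R by rewrite exprn_gt0.
set i := Num.truncn (2 ^+ M * t).
have i1 : i%:R <= 2 ^+ M * t by rewrite truncn_le mulr_ge0// ltW.
have i2 : 2 ^+ M * t < i.+1%:R by exact: truncnS_gt.
have iM : (i < 2 ^ M)%N.
  by rewrite -(@ltr_nat R) natrX; apply: le_lt_trans i1 _; rewrite gtr_pMr.
have s1 : i%:R / 2 ^+ M <= t by rewrite ler_pdivrMr// mulrC.
have s2 : t <= i.+1%:R / 2 ^+ M by rewrite ler_pdivlMr// mulrC ltW.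
have s3 : i.+1%:R / 2 ^+ M = i%:R / 2 ^+ M + 1 / 2 ^+ M :> R.
  by rewrite -natr1 mulrDl.
have s4 : i.+1%:R / 2 ^+ M <= 1 :> R.
  by rewrite ler_pdivrMr// mul1r -natrX ler_nat.
have s0 : 0 <= i%:R / 2 ^+ M :> R by rewrite divr_ge0// ltW.
have h1 := margin_dev_sandwich j w s0 s1 (ltW t1).
have h2 := margin_dev_sandwich j w t0 s2 s4.
have h3 : n%:R * (t - i%:R / 2 ^+ M) <= n%:R / 2 ^+ M.
  by rewrite ler_wpM2l//; lra.
have h4 : n%:R * (i.+1%:R / 2 ^+ M - t) <= n%:R / 2 ^+ M.
  by rewrite ler_wpM2l//; lra.
have := dyadic' _ iM; have := dyadic' _ (ltnW iM).
rewrite !ler_norml => /andP[? ?] /andP[? ?]; apply/andP; split; lra.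
Qed.

(** The largest [M] satisfying the first inequality. That one allows [bernstein] at the finest
    level; the second makes the finest mesh negligible. *)
Lemma dyadic_depth D : 1 <= D -> 16 * D <= n%:R ->
  exists M, 16 * D * 4 ^+ M <= n%:R /\ n%:R <= 16 * D * 4 ^+ M.+1.
Proof.
move=> D1 Dn; pose p M := 16 * D * 4 ^+ M <= n%:R.
have exp : exists M, p M by exists 0%N; rewrite /p expr0 mulr1.
have ubp M : p M -> (M <= n)%N.
  move=> /(le_trans _) h; rewrite -(@ler_nat R); apply: h.
  apply: (@le_trans _ _ (4 ^+ M)).
    by rewrite -natrX ler_nat ltnW// ltn_expl.
  by rewrite ler_peMl ?exprn_ge0//; lra.
have [M pM Mmax] := ex_maxnP exp ubp; exists M; split => //.
by rewrite leNgt; apply/negP => /ltW/Mmax; rewrite ltnn.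
Qed.

Lemma margin_dev_uniform j D : 1 <= D -> 16 * D <= n%:R ->
  fails_with_pr P (expR (- D)) (fun w => margin_dev j 0 w = 0 ->
    forall t, 0 <= t <= 1 -> `|margin_dev j t w| <= 56 * Num.sqrt (n%:R * D)).
Proof.
move=> D1 Dn; have [M [M1 M2]] := dyadic_depth D1 Dn.
apply: fails_with_pr_mono (chain_event_pr j D1 M1) => // w hw d0.
by apply: (@chaining_bound j D M) => //; lra.
Qed.

End dyadic_chaining.

(** * Absence of zeros and ties among the uniformized observations *)

Section almost_sure_properties.
Context {R : realType} {d : nat} {disp : measure_display}
  {Omega : measurableType disp} (P : probability Omega R) {n : nat}
  (X : 'I_n -> {RV P >-> d.-tuple R}) (mu : probability (d.-tuple R) R).
Hypothesis iid : iid_sample X mu.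
Hypothesis cF : forall j, continuous (marginal_cdf mu j).
Implicit Types (j : 'I_d) (i : 'I_n) (w : Omega).

Definition unif_obs i j w : R := marginal_cdf mu j (tnth (X i w) j).

Lemma measurable_preimage i (B : set (d.-tuple R)) : measurable B ->
  measurable (X i @^-1` B).
Proof.
by move=> mB; rewrite -[_ @^-1` _]setTI; apply: measurable_funPT.
Qed.

Lemma pr_preimage i (B : set (d.-tuple R)) : measurable B ->
  pr P (X i @^-1` B) = pr mu B.
Proof. by move=> mB; have [_ law] := iid; rewrite /pr -(law i). Qed.

Lemma pr_preimageI i l (B : set (d.-tuple R)) : i != l -> measurable B ->
  pr P (X i @^-1` B `&` X l @^-1` B) = pr mu B ^+ 2.
Proof.
move=> il mB; have [ind law] := iid.
pose D (p : 'I_n) := if (p == i) || (p == l) then B else setT.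
have mD p : measurable (D p) by rewrite /D; case: ifP.
have := ind D mD; rewrite (_ : [set w | _] = X i @^-1` B `&` X l @^-1` B); last first.
  apply/seteqP; split=> [w h|w [h1 h2] p].
    by split; [have := h i|have := h l]; rewrite /D eqxx ?orbT.
  by rewrite /D; case: eqP => [->//|_]; case: eqP => [->|].
rewrite (bigD1 i)//= (bigD1 l) 1?eq_sym//= big1 => [|p /andP[pi pl]]; last first.
  by rewrite /D (negbTE pi) (negbTE pl) preimage_setT probability_setT.
rewrite mule1 => h0.
have h : P (X i @^-1` B `&` X l @^-1` B) = (P (X i @^-1` B) * P (X l @^-1` B))%E.
  by rewrite h0 /D !eqxx orbT.
by rewrite /pr h !(prE P (measurable_preimage _ mB)) /= !pr_preimage.
Qed.

Lemma unif_obs_gt0 :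
  fails_with_pr P 0 (fun w => forall (j : 'I_d) (i : 'I_n), 0 < unif_obs i j w).
Proof.
have h j i : fails_with_pr P 0 (fun w => 0 < unif_obs i j w).
  exists (~` (X i @^-1` unif_le mu j 0)); split.
  - by apply: measurableC; apply: measurable_preimage; exact: measurable_unif_le.
  - rewrite setCK pr_preimage; last exact: measurable_unif_le.
    by rewrite pr_unif_le// lexx ler01.
  - by move=> w /= /negP; rewrite -ltNge.
have h' j : fails_with_pr P (\sum_(i < n) 0) (fun w => forall i : 'I_n, 0 < unif_obs i j w).
  by apply: fails_with_pr_all => i; exact: h.
apply: fails_with_pr_mono (fails_with_pr_all h') => //.
by rewrite big1// => j _; rewrite big1.
Qed.

(** The cells [(c / m, (c + 1) / m]] with [1 / m < e] cover [(0, 1]]. A tie puts both observations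
    in one cell, which by independence has probability at most [m m^-2]. The value 0 lies in no
    cell, whence the premise. An arbitrary positive [e] avoids passing to a null event. *)
Lemma distinct_pair j i l (e : R) : i != l -> 0 < e ->
  fails_with_pr P e (fun w => 0 < unif_obs i j w -> unif_obs i j w != unif_obs l j w).
Proof.
move=> il e0; pose m := (Num.truncn e^-1).+1.
have me : e^-1 < m%:R by exact: truncnS_gt.
have m0 : 0 < m%:R :> R by rewrite ltr0n.
pose I (c : 'I_m) := unif_le mu j (c.+1%:R / m%:R) `\` unif_le mu j (c%:R / m%:R).
have mI c : measurable (I c) by apply: measurableD; exact: measurable_unif_le.
have prI c : pr mu (I c) = m%:R^-1.
  have c1 : c.+1%:R / m%:R <= 1 :> R by rewrite ler_pdivrMr// mul1r ler_nat.
  have cc : c%:R / m%:R <= c.+1%:R / m%:R :> R.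
    by rewrite ler_pM2r ?invr_gt0// ler_nat.
  have c0 : 0 <= c%:R / m%:R :> R by rewrite divr_ge0.
  rewrite prD; try exact: measurable_unif_le; last exact: unif_le_nd.
  rewrite !pr_unif_le//; try by apply/andP; split; lra.
  by rewrite -mulrBl -natr1 addrAC subrr add0r mul1r.
pose Bad := \big[setU/set0]_c (X i @^-1` I c `&` X l @^-1` I c).
have mB c : measurable (X i @^-1` I c `&` X l @^-1` I c).
  by apply: measurableI; exact: measurable_preimage.
exists (~` Bad); split.
- by apply: measurableC; exact: bigsetU_measurable.
- rewrite setCK; apply: le_trans (pr_bigU P _ _ mB) _.
  rewrite (eq_bigr (fun=> m%:R^-1 ^+ 2)); last by move=> c _; rewrite pr_preimageI// prI.
  rewrite sumr_const card_ord -[leLHS]mulr_natl expr2 mulrA divff ?gt_eqF// mul1r.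
  by rewrite -[leRHS]invrK lef_pV2 ?posrE ?invr_gt0// ltW.
- move=> w nb Ui; apply/eqP => Uil; apply: nb.
  have U1 : unif_obs i j w <= 1 by exact: marginal_cdf_le1.
  pose p c := unif_obs i j w <= c.+1%:R / m%:R.
  have ep : exists c, p c by exists m.-1; rewrite /p prednK// divff// gt_eqF.
  have [c pc cmin] := ex_minnP ep.
  have cm : (c < m)%N.
    by rewrite -[X in (_ < X)%N](@prednK m)// ltnS cmin// /p prednK// divff// gt_eqF.
  have cU : c%:R / m%:R < unif_obs i j w.
    case: c {pc cm} cmin => [|c] cmin; first by rewrite mul0r.
    by rewrite ltNge; apply/negP => /cmin; rewrite ltnn.
  rewrite /Bad -bigcup_seq; exists (Ordinal cm); rewrite /= ?mem_index_enum//.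
  split; split; rewrite /unif_le /= -?/(unif_obs i j w) -?/(unif_obs l j w) -?Uil//.
    by apply/negP; rewrite -ltNge.
  by apply/negP; rewrite -ltNge.
Qed.

Lemma unif_obs_distinct (e : R) : 0 < e ->
  fails_with_pr P e (fun w =>
    (forall j i, 0 < unif_obs i j w) /\ forall j, injective (unif_obs ^~ j ^~ w)).
Proof.
move=> e0.
pose I := ('I_d * ('I_n * 'I_n))%type.
pose Q (q : I) w := let: (j, (i, l)) := q in
  i != l -> 0 < unif_obs i j w -> unif_obs i j w != unif_obs l j w.
pose e' := e / (#|{: I}|.+1)%:R.
have e'0 : 0 < e' by rewrite divr_gt0.
have hQ q : fails_with_pr P e' (Q q).
  case: q => j [i l]; rewrite /Q; have [->|il] := eqVneq i l.
    by apply: fails_with_pr_mono (fails_with_pr_true P (ltW e'0)).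
  by apply: fails_with_pr_mono (distinct_pair j il e'0).
apply: fails_with_pr_mono (fails_with_pr_and unif_obs_gt0 (fails_with_pr_all_const hQ)).
  rewrite add0r /e' mulrCA ler_piMr ?(ltW e0)//.
  by rewrite ler_pdivrMr ?ltr0n// mul1r ler_nat.
move=> w [h0 h]; split => // j i l /= E; apply/eqP/negPn/negP => il.
by have := h (j, (i, l)) il (h0 j i); rewrite E eqxx.
Qed.

End almost_sure_properties.

(** * Empirical quantiles of a sample without ties *)

Section empirical_quantile.
Context {R : realType} {n : nat} (x : 'I_n -> R).
Hypothesis x_inj : injective x.
Hypothesis x_gt0 : forall i, 0 < x i.
Hypothesis x_le1 : forall i, x i <= 1.

Let rank i := #|[pred l | x l <= x i]|.

Lemma rank_le i l : (rank i <= rank l)%N = (x i <= x l).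
Proof.
apply/idP/idP => [|il]; last first.
  by apply: subset_leq_card; apply/fintype.subsetP => p; rewrite !inE => /le_trans; apply.
apply: contraLR; rewrite -ltNge -ltnNge => li.
apply: proper_card; apply/fintype.properP; split.
  by apply/fintype.subsetP => p; rewrite !inE => /le_trans; apply; exact: ltW.
by exists i; rewrite !inE// -ltNge.
Qed.

(** Without ties the rank, shifted down by one, is an injective self-map of ['I_n], hence onto. *)
Lemma rank_onto m : (0 < m)%N -> (m <= n)%N -> exists i, rank i = m.
Proof.
move=> m0 mn.
have r0 i : (0 < rank i)%N by apply/card_gt0P; exists i; rewrite inE lexx.
have rn i : ((rank i).-1 < n)%N.
  by rewrite prednK// -[X in (_ <= X)%N]card_ord; exact: max_card.
have finj : injective (fun i => Ordinal (rn i)).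
  move=> i l [E]; apply: x_inj; apply/le_anti; rewrite -!rank_le.
  by rewrite -(prednK (r0 i)) -(prednK (r0 l)) E !leqnn.
have mn' : (m.-1 < n)%N by rewrite prednK.
have [g _ gK] := injF_bij finj.
exists (g (Ordinal mn')); have := gK (Ordinal mn') => /(congr1 val)/= E.
by rewrite -(prednK (r0 _)) E prednK.
Qed.

(** With [m] the integer part of [n u], [v] is the [m]-th smallest value, or 0 if [m = 0]. At
    [u = 1] the choice is [v = 1] rather than the largest value, so that coordinates equal to 1 stay
    fixed. *)
Lemma empirical_quantile (u : R) : 0 <= u <= 1 -> exists v, [/\ 0 <= v <= 1,
  forall i, ((rank i)%:R / n%:R <= u) = (x i <= v),
  `|\sum_(i < n) (x i <= v)%R%:R - n%:R * u| <= 1,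
  u = 1 -> v = 1 & u = 0 -> v = 0].
Proof.
move=> /andP[u0 u1]; set m := Num.truncn (n%:R * u).
have nu0 : 0 <= n%:R * u by rewrite mulr_ge0.
have m1 : m%:R <= n%:R * u by rewrite truncn_le.
have m2 : n%:R * u < m.+1%:R by exact: truncnS_gt.
have mn : (m <= n)%N by rewrite -(@ler_nat R) (le_trans m1)// ler_piMr.
have mnu : `|m%:R - n%:R * u| <= 1.
  by rewrite ler_norml; apply/andP; move: m2; rewrite -natr1; split; lra.
have rE i : ((rank i)%:R / n%:R <= u) = (rank i <= m)%N.
  have n0 : (0 < n)%N by exact: leq_ltn_trans (ltn_ord i).
  by rewrite ler_pdivrMr ?ltr0n// mulrC /m truncn_ge_nat.
have r0 i : (0 < rank i)%N by apply/card_gt0P; exists i; rewrite inE lexx.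
have [uE|un1] := eqVneq u 1.
  exists 1; split; rewrite ?ler01 ?lexx//.
  - by move=> i; rewrite x_le1 uE ler_pdivrMr ?mul1r ?ler_nat;
      [rewrite -[X in (_ <= X)%N]card_ord max_card|
       rewrite ltr0n (leq_ltn_trans _ (ltn_ord i))].
  - rewrite (eq_bigr (fun=> 1)) => [|i _]; last by rewrite x_le1.
    by rewrite sumr_const card_ord uE mulr1 subrr normr0.
  - by rewrite uE => /eqP; rewrite oner_eq0.
have [m0|] := posnP m.
  exists 0; split; rewrite ?ler01 ?lexx//.
  - by move=> i; rewrite rE m0 leqNgt r0 leNgt x_gt0.
  - rewrite big1 => [|i _]; last by rewrite leNgt x_gt0.
    by rewrite -[0 in leLHS](_ : m%:R = 0)// m0.
  - by move=> uE; rewrite uE eqxx in un1.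
move=> m0; have [i0 r_i0] := rank_onto m0 mn.
exists (x i0); split; rewrite ?x_le1 ?(ltW (x_gt0 _))//.
- by move=> i; rewrite rE -r_i0 rank_le.
- rewrite -natr_sum (eq_bigr (fun i => if (x i <= x i0)%R then 1 else 0)%N).
    by rewrite -big_mkcond/= sum1_card (_ : #|_| = m).
  by move=> i _; case: (x i <= x i0).
- by move=> uE; rewrite uE eqxx in un1.
- by move=> uE; move: m0; rewrite /m uE mulr0 truncn0.
Qed.

End empirical_quantile.

(** * Mean value theorem and telescoping along coordinate directions *)

Section coordinate_paths.
Context {R : realType} {d : nat}.
Implicit Types (u v z p : 'rV[R]_d) (i j l : 'I_d) (s t r : R).

Definition upd z j t : 'rV[R]_d := \row_l (if l == j then t else z 0 l).

Definition mix u v (J : seq 'I_d) : 'rV[R]_d :=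
  \row_l (if l \in J then v 0 l else u 0 l).

Definition between s t r : bool := Num.min s t <= r <= Num.max s t.

Lemma between_l s t : between s t s.
Proof. by rewrite /between ge_min le_max lexx. Qed.

Lemma between_r s t : between s t t.
Proof. by rewrite /between ge_min le_max lexx !orbT. Qed.

Lemma between_trans s t r r' : between s t r -> between s r r' -> between s t r'.
Proof.
rewrite /between; case: (leP s t) => st; case: (leP s r) => sr; lra.
Qed.

Lemma between_dist s t r : between s t r -> `|r - s| <= `|t - s|.
Proof.
rewrite /between; case: (leP s t) => st /andP[h1 h2].
  by rewrite !ger0_norm ?subr_ge0//; lra.
by rewrite !ler0_norm ?subr_le0 ?(ltW st)//; lra.
Qed.

Lemma updD z j t h : upd z j (h + t) = h *: basis_vec (R := R) j + upd z j t.
Proof.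
apply/rowP => l; rewrite !mxE eqxx /=; case: (eqVneq l j) => _ /=.
  by rewrite mulr1.
by rewrite mulr0 add0r.
Qed.

(** Turns directional derivatives into derivatives of one-variable functions, to which the mean
    value theorem applies. *)
Lemma upd_quotient (g : 'rV[R]_d -> R) z j t :
  (fun h : R => h^-1 *: ((g \o shift (upd z j t)) (h *: basis_vec (R := R) j)
     - g (upd z j t))) =
  (fun h : R => h^-1 *: (((fun s => g (upd z j s)) \o shift t) (h *: (1 : R)) -
     g (upd z j t))).
Proof.
apply/funext => h /=; congr (_ *: (g _ - _)).
by rewrite -updD; congr (upd _ _ (_ + _)); rewrite /GRing.scale/= mulr1.
Qed.

Lemma is_derive_upd (g : 'rV[R]_d -> R) z j t :
  derivable g (upd z j t) (basis_vec j) ->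
  is_derive t 1 (fun s => g (upd z j s)) ('D_(basis_vec j) g (upd z j t)).
Proof.
move=> dg; split; first by move: dg; rewrite /derivable upd_quotient.
by rewrite /derive -upd_quotient.
Qed.

Lemma MVT_coordinate (g : 'rV[R]_d -> R) z j s t :
  (forall r, between s t r -> derivable g (upd z j r) (basis_vec j)) ->
  exists2 r, between s t r &
    g (upd z j t) - g (upd z j s) = 'D_(basis_vec j) g (upd z j r) * (t - s).
Proof.
have H a b : a <= b ->
    (forall r, a <= r <= b -> derivable g (upd z j r) (basis_vec j)) ->
    exists2 r, a <= r <= b &
    g (upd z j b) - g (upd z j a) = 'D_(basis_vec j) g (upd z j r) * (b - a).
  move=> ab dg.
  have [||c cab E] := @MVT_segment R (fun s => g (upd z j s))
    (fun s => 'D_(basis_vec j) g (upd z j s)) a b ab.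
  - move=> x /[!in_itv]/= /andP[ax xb]; apply: is_derive_upd; apply: dg.
    by rewrite !ltW.
  - apply: derivable_within_continuous => x /[!in_itv]/= xab.
    by have [] := is_derive_upd (dg x xab).
  - by exists c => //; move: cab; rewrite in_itv.
move=> dg; have [st|ts] := leP s t.
  have [|r rst E] := H s t st; first by move=> r rst; apply: dg; rewrite /between (min_idPl st) (max_idPr st).
  by exists r => //; rewrite /between (min_idPl st) (max_idPr st).
have [|r rst E] := H t s (ltW ts).
  by move=> r rst; apply: dg; rewrite /between (min_idPr (ltW ts)) (max_idPl (ltW ts)).
exists r; first by rewrite /between (min_idPr (ltW ts)) (max_idPl (ltW ts)).
by rewrite -opprB E -mulrN opprB.
Qed.

Lemma mix_cons u v j J : mix u v (j :: J) = upd (mix u v J) j (v 0 j).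
Proof.
by apply/rowP => l; rewrite !mxE inE; case: eqP => [->|].
Qed.

Lemma mix_upd u v j J : j \notin J -> mix u v J = upd (mix u v J) j (u 0 j).
Proof.
by move=> jJ; apply/rowP => l; rewrite !mxE; case: eqP => [->|//]; rewrite (negbTE jJ).
Qed.

Lemma mix_nil u v : mix u v [::] = u.
Proof. by apply/rowP => l; rewrite !mxE. Qed.

(** The premise covers a move of one coordinate from any partially updated point, so the order of
    the moves need not be tracked. *)
Lemma telescoping_mix (g : 'rV[R]_d -> R) u v (J : seq 'I_d) (c : R) : uniq J ->
  (forall j L, j \in J -> {subset L <= J} -> j \notin L ->
    `|g (upd (mix u v L) j (v 0 j)) - g (upd (mix u v L) j (u 0 j))| <= c) ->
  `|g (mix u v J) - g u| <= (size J)%:R * c.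
Proof.
elim: J => [|j J IH]; first by rewrite mix_nil subrr normr0 mul0r.
move=> /= /andP[jJ uJ] H; rewrite mix_cons -natr1 mulrDl mul1r.
rewrite (_ : _ - _ = (g (mix u v J) - g u) +
  (g (upd (mix u v J) j (v 0 j)) - g (upd (mix u v J) j (u 0 j)))); last first.
  by rewrite -(mix_upd u v jJ); ring.
apply: le_trans (ler_normD _ _) _; apply: lerD.
  apply: IH => // i L iJ LJ iL; apply: H => //; first by rewrite inE iJ orbT.
  by move=> l /LJ; rewrite inE orbC => ->.
by apply: H => //; [rewrite inE eqxx|move=> l; rewrite inE orbC => ->].
Qed.

End coordinate_paths.

(** * First-order expansion of the copula with weighted second derivatives *)

Section expansion.
Context {R : realType} {d : nat} (C : 'rV[R]_d -> R) (k : nat) (K : R).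
Hypothesis C_reg : second_order_regular C k K.
Implicit Types (u v z p : 'rV[R]_d) (i j l : 'I_d) (s t r : R).

(** The increments satisfy [|a b| <= kappa max(x, y)], and this maximum cancels the minimum of the
    inverses. The sign of [K] is free, hence the absolute value. *)
Lemma product_bound (D a b x y kappa : R) : 0 < x -> 0 < y ->
  a ^+ 2 <= kappa * x -> b ^+ 2 <= kappa * y ->
  `|D| <= K * Num.min x^-1 y^-1 -> `|D| * `|a| * `|b| <= `|K| * kappa.
Proof.
have H (D' a' b' x' y' : R) : 0 < x' -> x' <= y' ->
    a' ^+ 2 <= kappa * x' -> b' ^+ 2 <= kappa * y' ->
    `|D'| <= `|K| * y'^-1 -> `|D'| * (`|a'| * `|b'|) <= `|K| * kappa.
  move=> x0 xy ax bx Dy; have y0 : 0 < y' by exact: lt_le_trans xy.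
  have k0 : 0 <= kappa.
    by rewrite -(pmulr_lge0 _ x0); apply: le_trans ax; rewrite sqr_ge0.
  have ab : `|a'| * `|b'| <= kappa * y'.
    move: ax bx; rewrite -(real_normK (num_real a')) -(real_normK (num_real b')).
    have : kappa * x' <= kappa * y' by rewrite ler_wpM2l.
    nra.
  apply: (@le_trans _ _ (`|K| * y'^-1 * (kappa * y'))).
    by apply: ler_pM => //; rewrite mulr_ge0.
  by rewrite mulrACA [y'^-1 * _]mulVf ?gt_eqF// mulr1.
move=> x0 y0 ax by' DK.
have {}DK : `|D| <= `|K| * Num.min x^-1 y^-1.
  apply: le_trans DK _; rewrite ler_wpM2r ?ler_norm//.
  by rewrite le_min !invr_ge0 !ltW.
have [xy|yx] := leP x y; rewrite -mulrA.
  apply: (H D a b x y) => //; rewrite (min_idPr _) in DK => //.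
  by rewrite lef_pV2.
rewrite [`|a| * _]mulrC; apply: (H D b a y x) => //; first exact: ltW.
by rewrite (min_idPl _) in DK => //; rewrite lef_pV2// ltW.
Qed.

Lemma dotC_interior j u : 0 < u 0 j < 1 -> dotC C j u = 'D_(basis_vec j) C u.
Proof. by move=> /andP[u0 u1]; rewrite /dotC gt_eqF// lt_eqF. Qed.

Section box.
Variables (u v : 'rV[R]_d) (G : seq 'I_d) (kappa : R).
Hypothesis Wu : W k u.
Hypothesis Gin : forall j r, j \in G -> between (u 0 j) (v 0 j) r ->
  0 < r < 1 /\ (v 0 j - u 0 j) ^+ 2 <= kappa * (r * (1 - r)).

Definition in_box p := forall l,
  if l \in G then between (u 0 l) (v 0 l) (p 0 l) : Prop else p 0 l = u 0 l.

(** [Gin] at [r = u 0 l] forces [u 0 l < 1], so coordinates equal to 1 are outside [G] and stay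
    frozen. *)
Lemma in_box_W p : in_box p -> W k p.
Proof.
move=> bp; have [cu cardu] := Wu; split.
  move=> l; have := bp l; case: ifP => [lG /(Gin lG)[/andP[h1 h2] _]|_ ->//].
  by rewrite !ltW.
apply: leq_trans cardu; apply: subset_leq_card; apply/fintype.subsetP => l.
rewrite !inE; have := bp l; case: ifP => [lG _ _|_ ->//].
by have [/andP[]] := Gin lG (between_l _ _).
Qed.

Lemma in_box_interior p j : in_box p -> j \in G -> 0 < p 0 j < 1.
Proof. by move=> bp jG; have := bp j; rewrite jG => /(Gin jG)[]. Qed.

Lemma in_box_V p j : in_box p -> j \in G -> V j p.
Proof. by move=> bp jG; split; [have [] := in_box_W bp|exact: in_box_interior]. Qed.

(** Only the product of a second derivative with two displacements is bounded near the boundary, so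
    the variation of [dotC] is estimated together with the factor [|v 0 j - u 0 j|]. *)
Lemma dotC_variation j z : j \in G -> in_box z -> uniq G ->
  `|dotC C j z - dotC C j u| * `|v 0 j - u 0 j| <= (size G)%:R * (`|K| * kappa).
Proof.
move=> jG bz uG.
have -> : z = mix u z G.
  by apply/rowP => l; rewrite mxE; have := bz l; case: ifP.
rewrite -[`|v 0 j - u 0 j|]ger0_norm// -normrM mulrBl.
apply: (telescoping_mix (g := fun p => dotC C j p * `|v 0 j - u 0 j|) uG).
move=> i L iG LG iL; rewrite /= -mulrBl normrM normr_id.
have box r : between (u 0 i) (z 0 i) r -> in_box (upd (mix u z L) i r).
  move=> ri l; rewrite !mxE; case: eqP => [->|_].
    rewrite iG; apply: between_trans ri.
    by have := bz i; rewrite iG.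
  case: ifP => lG; last by case: ifP => // /LG; rewrite lG.
  by case: ifP => _; [have := bz l; rewrite lG|exact: between_l].
have [_ C2 C3] := C_reg.
have [r|r ri ->] := @MVT_coordinate R d (dotC C j) (mix u z L) i (u 0 i) (z 0 i).
  move=> ri; have [+ _] := C2 i j; apply; split; last exact: in_box_W (box _ ri).
  by split; exact: in_box_V (box _ ri) _.
have bp := box _ ri; set p := upd _ i r in bp *.
have vp : (V i `&` V j `&` W k) p.
  by split; [split; exact: in_box_V|exact: in_box_W].
have := C3 i j p vp; rewrite /ddotC => hD.
have zi : `|z 0 i - u 0 i| <= `|v 0 i - u 0 i|.
  by apply: between_dist; have := bz i; rewrite iG.
rewrite normrM; apply: (@le_trans _ _ (`|'D_(basis_vec i) (dotC C j) p| *
    `|v 0 i - u 0 i| * `|v 0 j - u 0 j|)).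
  by rewrite ler_wpM2r// ler_wpM2l.
have pi : between (u 0 i) (v 0 i) (p 0 i) by have := bp i; rewrite iG.
have pj : between (u 0 j) (v 0 j) (p 0 j) by have := bp j; rewrite jG.
have [/andP[pi0 pi1] ki] := Gin iG pi.
have [/andP[pj0 pj1] kj] := Gin jG pj.
apply: (@product_bound _ _ _ (p 0 i * (1 - p 0 i)) (p 0 j * (1 - p 0 j))) => //.
- by rewrite mulr_gt0// subr_gt0.
- by rewrite mulr_gt0// subr_gt0.
- by rewrite minC.
Qed.

(** The coordinates in [G] are moved one at a time. Each move yields [dotC] at an intermediate point
    of the box, and [dotC_variation] brings it back to [u]. *)
Lemma second_order_expansion : uniq G ->
  `|C (mix u v G) - C u - \sum_(j <- G) dotC C j u * (v 0 j - u 0 j)| <=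
  (size G)%:R * ((size G)%:R * (`|K| * kappa)).
Proof.
move=> uG; set c := (size G)%:R * (`|K| * kappa).
suff : forall L, uniq L -> {subset L <= G} ->
    `|C (mix u v L) - C u - \sum_(j <- L) dotC C j u * (v 0 j - u 0 j)| <=
    (size L)%:R * c by apply.
elim=> [_ _|j L IH /= /andP[jL uL] LG].
  by rewrite mix_nil big_nil subrr subr0 normr0 mul0r.
have jG : j \in G by apply: LG; rewrite inE eqxx.
have LG' : {subset L <= G} by move=> l lL; apply: LG; rewrite inE lL orbT.
have {}IH := IH uL LG'.
have box r : between (u 0 j) (v 0 j) r -> in_box (upd (mix u v L) j r).
  move=> rj l; rewrite !mxE; case: eqP => [->|_]; first by rewrite jG.
  case: ifP => lG; last by case: ifP => // /LG'; rewrite lG.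
  by case: ifP => _; [exact: between_r|exact: between_l].
have [C1 _ _] := C_reg.
have [r rj|r rj E] := @MVT_coordinate R d C (mix u v L) j (u 0 j) (v 0 j).
  have [+ _] := C1 j; apply; split; last exact: in_box_W (box _ rj).
  exact: in_box_V (box _ rj) _.
rewrite mix_cons big_cons -natr1 mulrDl mul1r.
rewrite -(mix_upd u v jL) in E.
rewrite -(dotC_interior (in_box_interior (box _ rj) jG)) in E.
have hv := dotC_variation jG (box _ rj) uG.
rewrite -normrM mulrBl -/c in hv.
apply: le_trans (lerD IH hv).
apply: le_trans (ler_normD _ _).
by rewrite le_eqVlt; apply/orP; left; apply/eqP; congr `|_|; lra.
Qed.

End box.

Hypothesis C_lip : forall u v, unit_cube u -> unit_cube v ->
  `|C v - C u| <= \sum_j `|v 0 j - u 0 j|.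

Lemma dotC_norm_le1 j u : W k u -> 0 < u 0 j < 1 -> `|dotC C j u| <= 1.
Proof.
move=> Wu uj; rewrite dotC_interior//; have [cu _] := Wu.
have [C1 _ _] := C_reg.
have Vu : (V j `&` W k) u by split.
have [/(_ u Vu) du _] := C1 j.
have near1 : \forall h \near (0:R)^',
    `|h^-1 *: ((C \o shift u) (h *: basis_vec (R := R) j) - C u)| <= 1.
  have /andP[u0 u1] := uj.
  (* [C_lip] holds on the cube only; [|h| < e] keeps the shifted point there. *)
  pose e := Num.min (u 0 j) (1 - u 0 j).
  have e0 : 0 < e by rewrite lt_min u0 subr_gt0.
  near=> h.
  have h0 : h != 0 by near: h; exact: nbhs_dnbhs_neq.
  have he : `|h| < e.
    near: h; apply: nbhs_dnbhs; apply: (@nbhs0_lt R R e e0).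
  have ch : unit_cube (h *: basis_vec (R := R) j + u).
    move=> l; rewrite !mxE /=; have /andP[l0 l1] := cu l.
    case: (eqVneq l j) => [->|_]; last by rewrite mulr0 add0r l0 l1.
    rewrite mulr1; move: he; rewrite lt_min !ltr_norml => /andP[/andP[? ?] /andP[? ?]].
    by apply/andP; split; lra.
  rewrite normrZ normfV ler_pdivrMl ?normr_gt0// mulr1.
  apply: le_trans (C_lip cu ch) _; rewrite (bigD1 j)//= big1.
    by rewrite !mxE /= eqxx mulr1 addr0 addrK.
  by move=> l lj; rewrite !mxE /= (negbTE lj) mulr0 add0r subrr normr0.
rewrite ler_norml; apply/andP; split.
  apply: limr_ge => //; apply: filterS near1 => h; rewrite ler_norml.
  by case/andP.
apply: limr_le => //; apply: filterS near1 => h; rewrite ler_norml.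
by case/andP.
Unshelve. all: by end_near.
Qed.

End expansion.

(** * Deterministic analysis on the good event *)

Section pathwise.
Context {R : realType} {d : nat} {disp : measure_display}
  {Omega : measurableType disp} (P : probability Omega R) {n : nat}
  (X : 'I_n -> {RV P >-> d.-tuple R}) (mu : probability (d.-tuple R) R)
  (C : 'rV[R]_d -> R).
Hypothesis cF : forall j, continuous (marginal_cdf mu j).
Hypothesis CC : copula_of C mu.
Variable w : Omega.
Hypothesis U_gt0 : forall j i, 0 < unif_obs X mu i j w.
Hypothesis U_inj : forall j, injective (unif_obs X mu ^~ j ^~ w).
Implicit Types (u v : 'rV[R]_d) (j : 'I_d) (i : 'I_n) (t : R).

Local Notation F := (marginal_cdf mu).
Local Notation x := (X ^~ w).

(** [F j] may be flat, so it reflects the order of the observations only because their images are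
    distinct. *)
Lemma max_rank_unif i j :
  max_rank x i j = #|[pred l | unif_obs X mu l j w <= unif_obs X mu i j w]|.
Proof.
apply: eq_card => l; rewrite !inE; apply/idP/idP => [|h].
  exact: marginal_cdf_nd.
rewrite leNgt; apply/negP => il.
have E : unif_obs X mu i j w = unif_obs X mu l j w.
  by apply/le_anti; rewrite h andbT; apply: marginal_cdf_nd; exact: ltW.
by move: il; rewrite (U_inj E) ltxx.
Qed.

Lemma countE (B : set (d.-tuple R)) (b : 'I_n -> bool) :
  (forall i, reflect (B (X i w)) (b i)) -> count X B w = \sum_i (b i)%:R.
Proof.
by move=> h; apply: eq_bigr => i _; congr (nat_of_bool _)%:R; apply/asboolP/h.
Qed.

Lemma alphaE u : unit_cube u -> alpha F C x u = (Num.sqrt n%:R)^-1 * dev X mu u w.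
Proof.
move=> cu; rewrite /alpha /dev /deviation; congr (_ * _).
rewrite sumrB sumr_const card_ord -(copula_uniformized cF CC cu) mulr_natl.
congr (_ - _); rewrite (countE (b := fun i => [forall j, F j (tnth (x i) j) <= u 0 j]))//.
by move=> i; apply: (iffP forallP).
Qed.

Definition margin_point j t : 'rV[R]_d := \row_l (if l == j then t else 1).

Lemma margin_point_cube j t : 0 <= t <= 1 -> unit_cube (margin_point j t).
Proof. by move=> h l; rewrite mxE; case: ifP => // _; rewrite ler01 lexx. Qed.

Lemma dev_margin_point j t : dev X mu (margin_point j t) w = margin_dev X mu j t w.
Proof.
rewrite /dev /margin_dev; congr (deviation _ _ _ _); apply/seteqP; split=> y.
  by move=> /(_ j); rewrite mxE eqxx.
move=> h l; rewrite mxE; case: eqP => [->//|_]; exact: marginal_cdf_le1.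
Qed.

Lemma alpha_marginE j t : 0 <= t <= 1 ->
  alpha_margin F C x j t = (Num.sqrt n%:R)^-1 * margin_dev X mu j t w.
Proof.
move=> ht; rewrite /alpha_margin alphaE; last exact: margin_point_cube.
by rewrite dev_margin_point.
Qed.

Lemma margin_dev0 j : margin_dev X mu j 0 w = 0.
Proof.
rewrite /margin_dev /deviation pr_unif_le ?lexx ?ler01// mulr0 subr0.
rewrite /count big1// => i _; rewrite asboolF//=.
by apply/negP; rewrite -ltNge; exact: U_gt0.
Qed.

(** The last clause says that the number of points whose [j]-th uniformized coordinate is at most
    [v 0 j] is within 1 of [n (u 0 j)]: up to rounding, the displacement is the opposite of the
    marginal process at [v 0 j]. *)
Lemma quantile_vector u : unit_cube u -> (0 < n)%N -> exists v, [/\ unit_cube v,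
  forall j, u 0 j = 1 -> v 0 j = 1, forall j, u 0 j = 0 -> v 0 j = 0,
  empirical_copula x u = n%:R^-1 * count X (orthant mu v) w &
  forall j, `|n%:R * (v 0 j - u 0 j) + margin_dev X mu j (v 0 j) w| <= 1].
Proof.
move=> cu n0.
have Q j := @empirical_quantile R n (fun i => unif_obs X mu i j w) (@U_inj j)
  (U_gt0 j) (fun i => marginal_cdf_le1 mu j _) (u 0 j) (cu j).
have [f hf] := choice Q; exists (\row_j f j); split.
- by move=> j; rewrite mxE; have [] := hf j.
- by move=> j; rewrite mxE; have [] := hf j.
- by move=> j; rewrite mxE; have [] := hf j.
- rewrite /empirical_copula; congr (_ * _); symmetry; apply: countE => i.
  apply: (iffP forallP) => h j.
    have [_ h2 _ _ _] := hf j; have := h j; rewrite /pseudo_obs max_rank_unif h2.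
    by rewrite mxE.
  have [_ h2 _ _ _] := hf j; have := h j; rewrite /pseudo_obs max_rank_unif h2.
  by rewrite mxE.
- move=> j; rewrite mxE; have [h1 h2 h3 _ _] := hf j.
  rewrite /margin_dev /deviation pr_unif_le//.
  rewrite (countE (b := fun i => unif_obs X mu i j w <= f j)); last first.
    by move=> i; exact: idP.
  move: h3; set N := \sum_(i < n) _.
  by rewrite (_ : n%:R * (f j - u 0 j) + _ = N - n%:R * u 0 j)//; ring.
Qed.

Variables (k : nat) (K a l Delta : R).
Hypothesis k2 : (2 <= k)%N.
Hypothesis d0 : (0 < d)%N.
Hypothesis n0 : (0 < n)%N.
Hypothesis C_reg : second_order_regular C k K.
Hypothesis grid_ok : grid_event X mu k a l w.
Hypothesis margin_ok : forall j t, 0 <= t <= 1 -> `|margin_dev X mu j t w| <= Delta.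
Hypothesis k_le_l : k%:R <= l.
Hypothesis l_le_na : l <= n%:R * a.
Hypothesis Delta_le_na : Delta + 1 <= n%:R * a.

(** The common order of all error terms: [a] bounds the displacements and [l] is the logarithmic
    level. *)
Let S := Num.sqrt (n%:R * a * l).

Let n0' : 0 < n%:R :> R. Proof. by rewrite ltr0n. Qed.
Let k2' : 2 <= k%:R :> R. Proof. by rewrite (ler_nat _ 2). Qed.
Let l0 : 0 < l. Proof. by apply: lt_le_trans k_le_l; exact: lt_le_trans k2'. Qed.
Let a0 : 0 < a. Proof. by rewrite -(pmulr_rgt0 _ n0') (lt_le_trans l0). Qed.
Let S0 : 0 <= S. Proof. exact: sqrtr_ge0. Qed.

Let l_le_S : l <= S.
Proof.
rewrite -[leLHS]ger0_norm ?(ltW l0)// -sqrtr_sqr; apply: ler_wsqrtr.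
by rewrite expr2 ler_pM2r.
Qed.

Let sqrt_le_S (q c : R) : 0 <= c -> q <= c ^+ 2 * a ->
  Num.sqrt (n%:R * q * l) <= c * S.
Proof.
move=> c0 qc; rewrite -[c]ger0_norm// -sqrtr_sqr -sqrtrM ?sqr_ge0//.
apply: ler_wsqrtr; rewrite mulrA ler_pM2r// mulrCA ler_pM2l//.
Qed.

Let osc u v (e : R) : W k u -> unit_cube v -> 0 <= e ->
  (forall j, u 0 j <= v 0 j) -> (forall j, v 0 j <= u 0 j + e) ->
  `|dev X mu v w - dev X mu u w| <= 14 * Num.sqrt (n%:R * (k%:R * e + 2 * a) * l).
Proof. by move=> *; exact: (dev_osc cF n0 d0 grid_ok). Qed.

(** Both points are compared with their componentwise minimum, which remains in [W k] since no
    coordinate equal to 1 is lowered. As [k >= 2], [k a + 2 a <= k^2 a], so each comparison costs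
    [14 k S]. *)
Lemma dev_osc_close u v : W k u -> unit_cube v ->
  (forall j, u 0 j = 1 -> v 0 j = 1) -> (forall j, `|v 0 j - u 0 j| <= a) ->
  `|dev X mu v w - dev X mu u w| <= 28 * k%:R * S.
Proof.
move=> Wu cv uv1 uva; have [cu cardu] := Wu.
pose m : 'rV[R]_d := \row_j Num.min (u 0 j) (v 0 j).
have mu' j : m 0 j <= u 0 j by rewrite mxE ge_min lexx.
have mv' j : m 0 j <= v 0 j by rewrite mxE ge_min lexx orbT.
have Wm : W k m.
  split; first by move=> j; rewrite mxE /Num.min; case: ifP.
  apply: leq_trans cardu; apply: subset_leq_card; apply/fintype.subsetP => j.
  rewrite !inE mxE gt_min => /orP[//|vj]; have /andP[_ uj] := cu j.
  rewrite lt_neqAle uj andbT; apply/eqP => /uv1 h; by rewrite h ltxx in vj.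
have mua j : u 0 j <= m 0 j + a.
  have := uva j; rewrite mxE ler_norml /Num.min; case: ifP => _ /andP[? ?]; lra.
have mva j : v 0 j <= m 0 j + a.
  have := uva j; rewrite mxE ler_norml /Num.min; case: ifP => _ /andP[? ?]; lra.
have h1 := osc Wm cu (ltW a0) mu' mua.
have h2 := osc Wm cv (ltW a0) mv' mva.
have h3 : Num.sqrt (n%:R * (k%:R * a + 2 * a) * l) <= k%:R * S.
  apply: sqrt_le_S => //; rewrite -mulrDl ler_pM2r// expr2.
  have := k2'; nra.
move: h1 h2; rewrite !ler_norml => /andP[? ?] /andP[? ?]; apply/andP; split; lra.
Qed.

Lemma margin_point_W j t : 0 <= t <= 1 -> W k (margin_point j t).
Proof.
move=> ht; split; first exact: margin_point_cube.
apply: leq_trans (ltnW k2); rewrite -[X in (_ <= X)%N](card1 j).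
apply: subset_leq_card.
by apply/fintype.subsetP => i; rewrite !inE mxE; case: eqP => // _; rewrite ltxx.
Qed.

Lemma margin_osc j s t : 0 <= s -> s <= t -> t <= 1 ->
  `|margin_dev X mu j t w - margin_dev X mu j s w| <=
  14 * Num.sqrt (n%:R * (k%:R * (t - s) + 2 * a) * l).
Proof.
move=> s0 st t1; rewrite -!dev_margin_point; apply: osc.
- by apply: margin_point_W; rewrite s0 (le_trans st).
- by apply: margin_point_cube; rewrite t1 (le_trans s0).
- by rewrite subr_ge0.
- by move=> i; rewrite !mxE; case: eqP.
- by move=> i; rewrite !mxE; case: eqP => _; lra.
Qed.

Lemma margin_osc_close j s t : 0 <= s <= 1 -> 0 <= t <= 1 -> `|t - s| <= a ->
  `|margin_dev X mu j t w - margin_dev X mu j s w| <= 14 * k%:R * S.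
Proof.
have H p q : 0 <= p <= 1 -> 0 <= q <= 1 -> `|q - p| <= a -> p <= q ->
    `|margin_dev X mu j q w - margin_dev X mu j p w| <= 14 * k%:R * S.
  move=> /andP[p0 p1] /andP[q0 q1] pqa pq; apply: le_trans (margin_osc j p0 pq q1) _.
  rewrite -[leRHS]mulrA ler_pM2l//; apply: sqrt_le_S => //.
  move: pqa; rewrite ger0_norm ?subr_ge0// => pqa.
  have h1 : k%:R * (q - p) <= k%:R * a by rewrite ler_wpM2l.
  have h2 : 0 <= (k%:R - 2) * (k%:R + 1) * a.
    by rewrite !mulr_ge0 ?(ltW a0)// ?subr_ge0// addr_ge0.
  rewrite expr2; lra.
move=> hs ht st; have [le_st|lt_ts] := leP s t; first exact: H.
by rewrite distrC; apply: H => //; [rewrite distrC|exact: ltW].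
Qed.

Let m (t : R) := Num.min t (1 - t).

(** The process vanishes at 0 and 1; comparison with the nearer endpoint gives an increment of
    length [m t], comparable to [t (1 - t)]. *)
Lemma margin_weighted j t : 0 <= t <= 1 ->
  `|margin_dev X mu j t w| <= 14 * Num.sqrt (n%:R * (k%:R * m t + 2 * a) * l).
Proof.
move=> /andP[t0 t1]; rewrite /m; case: (leP t (1 - t)) => _.
  have := margin_osc j (lexx 0) t0 t1.
  by rewrite margin_dev0 !subr0.
have := margin_osc j t0 t1 (lexx 1).
by rewrite margin_dev1 sub0r normrN.
Qed.

Lemma quantile_close j s t : 0 <= s <= 1 -> 0 <= t <= 1 ->
  `|n%:R * (t - s) + margin_dev X mu j t w| <= 1 -> `|t - s| <= a.
Proof.
move=> hs ht h; have hm := margin_ok j ht.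
rewrite -(ler_pM2l n0') -[in leLHS](ger0_norm (ltW n0')) -normrM.
move: h hm Delta_le_na; rewrite !ler_norml => /andP[? ?] /andP[? ?] ?.
apply/andP; split; lra.
Qed.

(** The displacement is governed by the process at [t]; [m t <= m s + a] moves the weight to [s],
    and the rounding error 1 is absorbed as [15 = 14 + 1]. *)
Lemma quantile_weighted j s t : 0 <= s <= 1 -> 0 <= t <= 1 ->
  `|n%:R * (t - s) + margin_dev X mu j t w| <= 1 ->
  n%:R * `|t - s| <= 15 * Num.sqrt (n%:R * (k%:R * (m s + 2 * a)) * l).
Proof.
have [kk aa ll] := And3 k2' a0 l0.
move=> hs ht h; have sta := quantile_close hs ht h.
set T := Num.sqrt _.
have mt : m t <= m s + a.
  move: sta; rewrite /m ler_norml /Num.min => /andP[? ?].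
  by case: ifP => ?; case: ifP => ?; lra.
have ms0 : 0 <= m s by rewrite /m le_min; have /andP[? ?] := hs; apply/andP; split; lra.
have h1 : `|margin_dev X mu j t w| <= 14 * T.
  apply: le_trans (margin_weighted j ht) _; rewrite ler_pM2l//.
  apply: ler_wsqrtr; rewrite ler_pM2r// ler_pM2l//; nra.
have T1 : 1 <= T.
  rewrite -[leLHS]sqrtr1; apply: ler_wsqrtr.
  have : n%:R * a * l <= n%:R * (k%:R * (m s + 2 * a)) * l.
    by rewrite ler_pM2r// ler_pM2l//; nra.
  have : l * l <= n%:R * a * l by rewrite ler_pM2r.
  have l2 : 2 <= l by exact: le_trans k_le_l.
  nra.
rewrite -[in leLHS](ger0_norm (ltW n0')) -normrM.
move: h h1; rewrite !ler_norml => /andP[? ?] /andP[? ?]; apply/andP; split; lra.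
Qed.

Lemma quantile_boundary j s t : 0 <= s <= 1 -> 0 <= t <= 1 ->
  `|n%:R * (t - s) + margin_dev X mu j t w| <= 1 -> m s < 4 * a ->
  n%:R * `|t - s| <= 45 * k%:R * S.
Proof.
have [kk aa ll] := And3 k2' a0 l0.
move=> hs ht h ms; apply: le_trans (quantile_weighted hs ht h) _.
rewrite (_ : 45 * k%:R * S = 15 * (3 * k%:R * S)); last by ring.
rewrite ler_pM2l//; apply: sqrt_le_S; first by rewrite mulr_ge0.
have : k%:R * (m s + 2 * a) <= k%:R * (6 * a) by rewrite ler_wpM2l//; lra.
have : k%:R * (6 * a) <= (3 * k%:R) ^+ 2 * a by rewrite mulrA ler_pM2r// expr2; nra.
lra.
Qed.

(** Since [|r - s| <= a <= m s / 4], one has [r (1 - r) >= 3 / 8 m s], while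
    [m s + 2 a <= 3 / 2 m s]. The constant is [900 = 15^2 (3 / 2) / (3 / 8)]. *)
Lemma quantile_interior j s t r : 0 <= s <= 1 -> 0 <= t <= 1 ->
  `|n%:R * (t - s) + margin_dev X mu j t w| <= 1 -> 4 * a <= m s ->
  between s t r ->
  0 < r < 1 /\ (t - s) ^+ 2 <= (900 * k%:R * l / n%:R) * (r * (1 - r)).
Proof.
have [kk aa ll] := And3 k2' a0 l0.
move=> hs ht h ms rst; have sta := quantile_close hs ht h.
have rs : `|r - s| <= a by exact: le_trans (between_dist rst) sta.
have [ms1 ms2] : m s <= s /\ m s <= 1 - s.
  by rewrite /m !ge_min !lexx orbT.
have [hr1 hr2] : 3 / 4 * m s <= r /\ 3 / 4 * m s <= 1 - r.
  by move: rs; rewrite ler_norml => /andP[? ?]; split; lra.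
have r01 : 0 < r < 1 by apply/andP; split; lra.
split => //.
have hm : 3 / 8 * m s <= r * (1 - r).
  have [r12|r12] := leP r (1 / 2); nra.
have /andP[r0 r1] := r01.
have h1 : (n%:R * `|t - s|) ^+ 2 <= 225 * (n%:R * (k%:R * (m s + 2 * a)) * l).
  have arg0 : 0 <= n%:R * (k%:R * (m s + 2 * a)) * l.
    by rewrite !mulr_ge0 ?(ltW l0) ?(ltW n0')//; lra.
  rewrite -[in leRHS](sqr_sqrtr arg0).
  rewrite (_ : 225 = 15 ^+ 2); last by ring.
  rewrite -exprMn; apply: lerXn2r; rewrite ?nnegrE ?mulr_ge0//.
  exact: quantile_weighted hs ht h.
move: h1; rewrite exprMn real_normK ?num_real// => h1.
rewrite -(ler_pM2l (exprn_gt0 2 n0')); apply: le_trans h1 _.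
rewrite (_ : n%:R ^+ 2 * _ = 900 * n%:R * k%:R * l * (r * (1 - r))); last first.
  by field; rewrite gt_eqF.
have c0 : 0 <= n%:R * k%:R * l by rewrite !mulr_ge0 ?(ltW l0).
have : (n%:R * k%:R * l) * (225 * (m s + 2 * a)) <=
       (n%:R * k%:R * l) * (900 * (r * (1 - r))) by rewrite ler_wpM2l//; lra.
lra.
Qed.

Lemma sum_below_one u (f : 'I_d -> R) (c : R) : W k u -> 0 <= c ->
  (forall j, u 0 j = 1 -> f j = 0) -> (forall j, u 0 j < 1 -> f j <= c) ->
  \sum_j f j <= k%:R * c.
Proof.
move=> [cu cardu] c0 f1 fc.
apply: (@le_trans _ _ (\sum_(j | u 0 j < 1) c)); last first.
  by rewrite sumr_const -[leLHS]mulr_natl ler_wpM2r// ler_nat.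
rewrite [leRHS]big_mkcond/=; apply: ler_sum => j _; case: ifP => [/fc//|/negbT].
rewrite -leNgt => uj; rewrite f1//; apply/le_anti; rewrite uj andbT.
by have /andP[] := cu j.
Qed.

Lemma pathwise_bound u : W k u ->
  `|Num.sqrt n%:R * (empirical_copula_process C x u - linearization F C x u)| <=
  k%:R + 1000 * k%:R ^+ 3 * (1 + `|K|) * S.
Proof.
move=> Wu; have [cu _] := Wu; have [kk aa ll] := And3 k2' a0 l0; have S0' := S0.
have [v [cv v1 v0 Cn hv]] := quantile_vector cu n0.
(* The threshold is four times the largest displacement, which keeps the whole segment from [u 0 j]
   to [v 0 j] off the boundary. *)
pose A : pred 'I_d := [pred j | (u 0 j < 1) && (4 * a <= m (u 0 j))].
pose G := enum A; pose z := mix u v G.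
have uG : uniq G by exact: enum_uniq.
have inG j : (j \in G) = A j by rewrite mem_enum.
have sizeG : (size G <= k)%N.
  have [_ cardu] := Wu; rewrite -cardE; apply: leq_trans cardu.
  by apply: subset_leq_card; apply/fintype.subsetP => j; rewrite !inE => /andP[].
have vua j : `|v 0 j - u 0 j| <= a by exact: quantile_close (cu j) (cv j) (hv j).
pose M j := margin_dev X mu j (u 0 j) w.
have M1 j : u 0 j = 1 -> M j = 0 by move=> uj; rewrite /M uj margin_dev1.
have M0 j : u 0 j = 0 -> M j = 0 by move=> uj; rewrite /M uj margin_dev0.
have hosc := dev_osc_close Wu cv v1 vua.
(* The linearization error is split along the vector [z] in which only the
   coordinates of [u] far from the boundary have been moved to [v]. *)
pose b j := dotC C j u * ((j \in G)%:R * (n%:R * (v 0 j - u 0 j)) + M j).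
have E : Num.sqrt n%:R * (empirical_copula_process C x u - linearization F C x u)
    = (dev X mu v w - dev X mu u w) + n%:R * (C v - C z)
    + n%:R * (C z - C u - \sum_(j <- G) dotC C j u * (v 0 j - u 0 j))
    + \sum_j b j.
  have sq : Num.sqrt n%:R * Num.sqrt n%:R = n%:R :> R by rewrite -expr2 sqr_sqrtr.
  have sq0 : Num.sqrt n%:R != 0 :> R by rewrite gt_eqF// sqrtr_gt0.
  rewrite mulrBr /empirical_copula_process mulrA sq Cn mulrBr mulrA divff ?gt_eqF// mul1r.
  have -> : count X (orthant mu v) w = dev X mu v w + n%:R * C v.
    by rewrite /dev /deviation -(copula_uniformized cF CC cv) subrK.
  rewrite /linearization mulrBr alphaE// mulrA divff// mul1r mulr_sumr.
  rewrite (eq_bigr (fun j => dotC C j u * M j)); last first.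
    move=> j _; rewrite alpha_marginE; last exact: cu.
    by rewrite mulrCA (mulrA (Num.sqrt _)) divff// mul1r.
  have -> : \sum_j b j = n%:R * (\sum_(j <- G) dotC C j u * (v 0 j - u 0 j)) +
      \sum_j dotC C j u * M j.
    have -> : \sum_(j <- G) dotC C j u * (v 0 j - u 0 j) =
        \sum_j (if A j then dotC C j u * (v 0 j - u 0 j) else 0).
      by rewrite -big_mkcond /G big_enum.
    rewrite mulr_sumr -big_split/=; apply: eq_bigr => j _.
    rewrite /b inG; case: (A j); first by rewrite mul1r; ring.
    by rewrite mul0r; ring.
  by ring.
have dotC0 j : u 0 j < 1 -> u 0 j != 0 -> `|dotC C j u| <= 1.
  move=> uj1 uj0; apply: (dotC_norm_le1 C_reg (copula_lipschitz CC)) => //.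
  by rewrite uj1 andbT lt_neqAle eq_sym uj0; have /andP[] := cu j.
have ez j : `|v 0 j - z 0 j| = (j \notin G)%:R * `|v 0 j - u 0 j|.
  rewrite mxE; case: (j \in G) => /=; first by rewrite subrr normr0 mul0r.
  by rewrite mul1r.
have cz : unit_cube z by move=> j; rewrite mxE; case: ifP.
have mlt j : u 0 j < 1 -> j \notin G -> m (u 0 j) < 4 * a.
  by move=> uj; rewrite inG /A /= uj /= -ltNge.
have T2 : `|n%:R * (C v - C z)| <= k%:R * (45 * k%:R * S).
  rewrite normrM ger0_norm ?(ltW n0')//.
  apply: (@le_trans _ _ (n%:R * \sum_j `|v 0 j - z 0 j|)).
    by rewrite ler_pM2l//; exact: (copula_lipschitz CC).
  rewrite mulr_sumr; apply: (@sum_below_one u) => //.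
  - by rewrite mulr_ge0.
  - by move=> j uj; rewrite ez v1// uj subrr normr0 !mulr0.
  - move=> j uj; rewrite ez; case jG: (j \in G) => /=; first by rewrite mul0r mulr0 mulr_ge0.
    rewrite mul1r; apply: (quantile_boundary (cu j) (cv j) (hv j)).
    by apply: mlt => //; rewrite jG.
have T3 : `|n%:R * (C z - C u - \sum_(j <- G) dotC C j u * (v 0 j - u 0 j))| <=
    900 * k%:R ^+ 3 * `|K| * S.
  pose kappa := 900 * k%:R * l / n%:R.
  have kap0 : 0 <= kappa by rewrite divr_ge0 ?ler0n ?mulr_ge0 ?ler0n ?(ltW ll).
  have h : `|C z - C u - \sum_(j <- G) dotC C j u * (v 0 j - u 0 j)| <=
      (size G)%:R * ((size G)%:R * (`|K| * kappa)).
    apply: (second_order_expansion C_reg Wu _ uG) => j r; rewrite inG => /andP[_ mj].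
    exact: quantile_interior (cu j) (cv j) (hv j) mj.
  have kapE : n%:R * kappa = 900 * k%:R * l by rewrite /kappa; field; rewrite gt_eqF.
  clearbody kappa; rewrite normrM ger0_norm ?(ltW n0')//.
  apply: (@le_trans _ _ (n%:R * (k%:R * (k%:R * (`|K| * kappa))))).
    rewrite ler_pM2l//; apply: le_trans h _.
    have sk : (size G)%:R <= k%:R :> R by rewrite ler_nat.
    by apply: ler_pM; rewrite ?mulr_ge0//; apply: ler_pM; rewrite ?mulr_ge0.
  rewrite (_ : n%:R * _ = 900 * k%:R ^+ 3 * `|K| * l).
    by apply: ler_wpM2l l_le_S; rewrite !mulr_ge0 ?ler0n ?exprn_ge0 ?ler0n ?normr_ge0.
  rewrite (_ : n%:R * _ = k%:R ^+ 2 * `|K| * (n%:R * kappa)); last by ring.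
  by rewrite kapE; ring.
(* In [G] the displacement cancels the marginal term up to rounding and an oscillation; outside [G]
   the marginal term is itself small. *)
have bj j : u 0 j < 1 -> `|b j| <= 1 + 28 * k%:R * S.
  move=> uj; have kS0 : 0 <= k%:R * S by rewrite mulr_ge0.
  (* At 0 the value of [dotC] is a one-sided upper limit that is not estimated; its factor
     vanishes. *)
  have [uj0|uj0] := eqVneq (u 0 j) 0.
    by rewrite /b M0// v0// uj0 subrr !mulr0 addr0 mulr0 normr0; lra.
  rewrite /b normrM; apply: le_trans (ler_piMl _ (dotC0 _ uj uj0)) _ => //.
  case jG: (j \in G).
    rewrite mul1r; have h1 := hv j; have h2 := margin_osc_close j (cu j) (cv j) (vua j).
    rewrite -/(M j) in h2.
    move: h1 h2; rewrite !ler_norml => /andP[? ?] /andP[? ?]; apply/andP; split; lra.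
  rewrite mul0r add0r /M; apply: le_trans (margin_weighted j (cu j)) _.
  have mj : m (u 0 j) < 4 * a by apply: mlt => //; rewrite jG.
  have : Num.sqrt (n%:R * (k%:R * m (u 0 j) + 2 * a) * l) <= 2 * k%:R * S.
    apply: sqrt_le_S; first by rewrite mulr_ge0.
    have h1 : k%:R * m (u 0 j) <= k%:R * (4 * a) by rewrite ler_wpM2l// ltW.
    have h2 : 0 <= (k%:R - 2) * (4 * k%:R + 4) * a.
      by rewrite !mulr_ge0 ?subr_ge0 ?addr_ge0 ?mulr_ge0 ?ler0n ?(ltW aa).
    rewrite exprMn !expr2; nra.
  lra.
have T4 : `|\sum_j b j| <= k%:R * (1 + 28 * k%:R * S).
  apply: le_trans (ler_norm_sum _ _ _) _; apply: (@sum_below_one u) => //.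
  - by rewrite addr_ge0// !mulr_ge0.
  - by move=> j uj; rewrite /b M1// v1// uj subrr !mulr0 addr0 mulr0 normr0.
rewrite E; apply: le_trans (ler_normD _ _) _.
apply: le_trans (lerD (ler_normD _ _) (lexx _)) _.
apply: le_trans (lerD (lerD (ler_normD _ _) (lexx _)) (lexx _)) _.
apply: le_trans (lerD (lerD (lerD hosc T2) T3) T4) _.
have K0 := normr_ge0 K.
(* All powers of [k] are raised to the third; the coefficients 28, 45, 28 and [900 |K|] fit in
   [1000 (1 + |K|)], and the roundings leave the term [k]. *)
have c1 : k%:R * S <= k%:R ^+ 3 * S by rewrite ler_wpM2r// -[leLHS]expr1 ler_weXn2l//; lra.
have c2 : k%:R * k%:R * S <= k%:R ^+ 3 * S.
  by rewrite -expr2 ler_wpM2r// ler_weXn2l//; lra.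
have c3 : 0 <= k%:R ^+ 3 * S by rewrite mulr_ge0// exprn_ge0.
have c4 : 0 <= k%:R ^+ 3 * S * `|K| by rewrite mulr_ge0.
lra.
Qed.

End pathwise.

(** * Comparison of [rate] with the logarithms of [n] and [delta] *)

Section rates.
Context {R : realType} (n : nat) (delta : R).
Hypothesis delta0 : 0 < delta.
Hypothesis delta_range : expR (- (n%:R / 32)) <= delta <= expR (- 1).

Local Notation D := (ln delta^-1).
Local Notation r := (rate n delta).

Lemma log_delta : expR (- D) = delta.
Proof. by rewrite lnV// opprK lnK. Qed.

Lemma log_delta_ge1 : 1 <= D.
Proof.
have /andP[_ h] := delta_range.
by rewrite -lerN2 -ler_expR log_delta.
Qed.

Lemma log_delta_le : 32 * D <= n%:R.
Proof.
have /andP[h _] := delta_range.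
have : D <= n%:R / 32 by rewrite -lerN2 -ler_expR log_delta.
by rewrite ler_pdivlMr// mulrC.
Qed.

Lemma sample_size_ge32 : 32 <= n%:R :> R.
Proof. by have := log_delta_le; have := log_delta_ge1; lra. Qed.

Let n0 : 0 < n%:R :> R.
Proof. by apply: lt_le_trans sample_size_ge32. Qed.

Lemma rate_sqr : 2 * n%:R * r ^+ 2 = D.
Proof.
have D1 := log_delta_ge1; have n0' := n0.
rewrite /rate sqr_sqrtr; first by field; rewrite gt_eqF.
by rewrite mulr_ge0 ?invr_ge0 ?mulr_ge0//; lra.
Qed.

Lemma rate_gt0 : 0 < r.
Proof.
have D1 := log_delta_ge1.
rewrite sqrtr_gt0 mulr_gt0 ?invr_gt0 ?mulr_gt0//; lra.
Qed.

Let y := n%:R * r.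

Let yy : 2 * y ^+ 2 = n%:R * D.
Proof. by rewrite -rate_sqr /y; ring. Qed.

Let y0 : 0 < y. Proof. by rewrite mulr_gt0// rate_gt0. Qed.

Let y4 : 4 <= y.
Proof.
have D1 := log_delta_ge1; have n32 := sample_size_ge32; have y0' := y0.
have h := yy; have h' : n%:R <= n%:R * D by rewrite ler_peMr// ltW.
rewrite leNgt; apply/negP => hy; have : y ^+ 2 < 16 by rewrite expr2; nra.
lra.
Qed.

Lemma sqrt_log_delta : Num.sqrt (n%:R * D) <= 3 / 2 * y.
Proof.
have y0' := y0; have n32 : 0 <= 3 / 2 * y by lra.
rewrite -[leRHS]ger0_norm// -sqrtr_sqr; apply: ler_wsqrtr.
by rewrite -yy [leRHS]exprMn; have := sqr_ge0 y; lra.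
Qed.

(** [56 (3 / 2) y + 1 = 84 y + 1], whereas the right side is at least [200 y] and [y >= 4]. *)
Lemma dkw_radius (k : nat) : (2 <= k)%N ->
  56 * Num.sqrt (n%:R * D) + 1 <= n%:R * (100 * k%:R * r).
Proof.
move=> k2; have k2' : 2 <= k%:R :> R by rewrite (ler_nat _ 2).
rewrite [leRHS](_ : _ = 100 * (k%:R * y)); last by rewrite /y; ring.
have h := sqrt_log_delta; have y4' := y4.
have : 2 * y <= k%:R * y by rewrite ler_wpM2r// ltW// y0.
lra.
Qed.

Lemma log_sample_split : ln (n%:R / delta) = ln n%:R + D.
Proof. by rewrite lnM ?posrE ?invr_gt0. Qed.

(** [ln n = 2 ln (sqrt n) <= 2 sqrt n <= 2 sqrt (n D) <= 3 y]. *)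
Lemma log_sample_le : ln (n%:R : R) <= 3 * y.
Proof.
have D1 := log_delta_ge1; have y0' := y0; have n0' := n0.
set s := Num.sqrt (n%:R : R).
have s0 : 0 < s by rewrite sqrtr_gt0.
have -> : n%:R = s * s :> R by rewrite -expr2 sqr_sqrtr// ltW.
rewrite lnM ?posrE//; have := ln_sublinear s0.
have : s <= Num.sqrt (n%:R * D) by apply: ler_wsqrtr; rewrite ler_peMr// ltW.
by have := sqrt_log_delta; lra.
Qed.

Lemma log_radius (k : nat) :
  8 * k%:R * ln (n%:R / delta) <= n%:R * (100 * k%:R * r).
Proof.
rewrite log_sample_split.
have h := log_sample_le; have y0' := y0.
have D1 := log_delta_ge1.
(* From [32 D^2 <= n D = 2 y^2], where the lower bound on [delta] enters. *)
have h1 : D <= y / 4.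
  have : 32 * D * D <= n%:R * D by rewrite ler_wpM2r ?log_delta_le//; lra.
  rewrite -yy => h2; rewrite leNgt; apply/negP => h3.
  have : (y / 4) ^+ 2 < D ^+ 2.
    by apply: ltrXn2r; rewrite ?nnegrE//; lra.
  rewrite !expr2; rewrite expr2 in h2; lra.
rewrite [leRHS](_ : _ = k%:R * (100 * y)); last by rewrite /y; ring.
rewrite [leLHS](_ : _ = k%:R * (8 * (ln n%:R + D))); last by ring.
rewrite ler_wpM2l//; lra.
Qed.

Lemma log_sample_ge1 : 1 <= ln (n%:R / delta).
Proof.
rewrite log_sample_split; have := log_delta_ge1.
have : 0 <= ln (n%:R : R) by apply: ln_ge0; have := sample_size_ge32; lra.
lra.
Qed.

(** Taking logarithms in [2 n r^2 = D] gives [- 2 ln r = ln 2 + ln n - ln D]; then [ln D <= D]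
    suffices. *)
Lemma log_sample_le_rate : ln (n%:R / delta) <= 2 * ln (1 / (delta * r)).
Proof.
have D1 := log_delta_ge1; have n0' := n0; have r0 := rate_gt0.
have D0 : 0 < D by lra.
have -> : ln (1 / (delta * r)) = D - ln r.
  rewrite mul1r invfM lnM ?posrE ?invr_gt0//; congr (_ + _).
  by rewrite lnV ?posrE.
rewrite log_sample_split.
have : ln D = ln (2 : R) + ln n%:R + (ln r + ln r).
  rewrite -rate_sqr expr2 !lnM ?posrE ?mulr_gt0//.
have := ln_sublinear D0.
have : 0 <= ln (2 : R) by apply: ln_ge0; lra.
lra.
Qed.

(** The exponential is [(delta / n)^(8 k)]. One half of the exponent pays for the
    [(n + 1)^(2 k) <= n^(4 k)] pairs, the other brings [2 (delta / n)^(4 k)] below [delta]. *)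
Lemma union_bound_small (k : nat) : (2 <= k)%N ->
  (n.+1%:R ^+ k) ^+ 2 * (2 * expR (- (8 * k%:R * ln (n%:R / delta)))) <= delta.
Proof.
move=> k2; have n32 := sample_size_ge32; have n0' := n0.
have /andP[_ d1] := delta_range.
have delta1 : delta <= 1.
  by apply: le_trans d1 _; rewrite -[leRHS]expR0 ler_expR; lra.
pose q := delta / n%:R.
have q0 : 0 < q by rewrite divr_gt0.
have -> : expR (- (8 * k%:R * ln (n%:R / delta))) = q ^+ (4 * k) * q ^+ (4 * k).
  rewrite -exprD -mulnDl (_ : (4 + 4 = 8)%N)// -[q]lnK ?posrE// -expRM_natl.
  congr expR; rewrite natrM /q -[delta / _]invrK lnV ?posrE ?invr_gt0//.
  by rewrite invf_div; ring.
have nn : n.+1%:R <= n%:R ^+ 2 :> R by rewrite -natr1 expr2; nra.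
have h1 : (n.+1%:R ^+ k) ^+ 2 <= n%:R ^+ (4 * k) :> R.
  rewrite -exprM mulnC (_ : (4 * k = 2 * (2 * k))%N); last by rewrite mulnA.
  by rewrite [leRHS]exprM; apply: lerXn2r; rewrite ?nnegrE ?exprn_ge0.
have h2 : n%:R ^+ (4 * k) * q ^+ (4 * k) <= 1.
  rewrite -exprMn /q mulrC divfK ?gt_eqF//.
  by apply: exprn_ile1 => //; exact: ltW.
have q1 : q <= delta / 2.
  by rewrite /q ler_pM2l// lef_pV2 ?posrE//; lra.
have h3 : q ^+ (4 * k) <= q.
  rewrite -[leRHS]expr1; apply: ler_wiXn2l; [exact: ltW|lra|].
  by rewrite muln_gt0/= ltnW.
have qk0 : 0 <= q ^+ (4 * k) by rewrite exprn_ge0// ltW.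
have h4 : (n.+1%:R ^+ k) ^+ 2 * q ^+ (4 * k) <= 1.
  by apply: le_trans h2; rewrite ler_wpM2r.
have h5 := ler_wpM2r qk0 h4.
have h6 : (n.+1%:R ^+ k) ^+ 2 * (2 * (q ^+ (4 * k) * q ^+ (4 * k))) =
   2 * ((n.+1%:R ^+ k) ^+ 2 * q ^+ (4 * k) * q ^+ (4 * k)) by ring.
rewrite h6; lra.
Qed.

End rates.

Theorem theorem4p1 (R : realType) (k : nat) (K : R) (hk : (2 <= k)%N) :
  exists L1 L2 : R, 0 < L1 /\ 0 < L2 /\
  forall (d : nat) (C : 'rV[R]_d -> R) (mu : probability (d.-tuple R) R)
    (disp : measure_display) (Omega : measurableType disp)
    (P : probability Omega R) (n : nat) (X : 'I_n -> {RV P >-> d.-tuple R})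
    (delta : R),
  (2 <= d)%N -> (k <= d)%N ->
  (forall j : 'I_d, continuous (marginal_cdf mu j)) ->
  copula_of C mu ->
  iid_sample X mu ->
  second_order_regular C k K ->
  0 < delta -> expR (- (n%:R / 32)) <= delta <= expR (- 1) ->
  let r := rate n delta in
  exists A : set Omega,
    [/\ measurable A,
        (1 - (9 * d%:R + d%:R ^+ k) * delta)%:E <= P A
      & forall w, A w ->
          ereal_sup [set `|empirical_copula_process C (X ^~ w) u
                          - linearization (marginal_cdf mu) C (X ^~ w) u|%:E
                    | u in W k]
          <= (2 * k%:R / Num.sqrt n%:R
              + L1 * Num.sqrt (r * ln (L2 / (delta * r))))%:E]%E.
Proof.
have c0 : 0 < 1000 :> R by lra.
have c1 : 0 < 40 :> R by lra.
have k0' : 0 < k%:R :> R by rewrite ltr0n ltnW.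
have K1 : 0 < 1 + `|K| by rewrite ltr_pwDl.
(* The factor [1000 k^3 (1 + |K|)] is that of [pathwise_bound]; [40 k] comes from comparing
   [sqrt (a l)] with the root in the statement. *)
exists (1000 * (40 * k%:R ^+ 4 * (1 + `|K|))), 1; split; [|split; first exact: ltr01].
  apply: mulr_gt0 c0 _; apply: mulr_gt0 K1; apply: mulr_gt0 c1 _.
  by rewrite exprn_gt0.
move=> d C mu disp Omega P n X delta d2 kd cF CC iid C_reg delta0 delta_range r.
have n32 := sample_size_ge32 delta0 delta_range.
have n0 : (0 < n)%N by rewrite -(ltr_nat R); apply: lt_le_trans n32; rewrite ltr0n.
have n0' : 0 < n%:R :> R by rewrite ltr0n.
have r0 : 0 < r := rate_gt0 delta0 delta_range.
have d0 : (0 < d)%N by exact: ltnW.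
have D1 := log_delta_ge1 delta0 delta_range.
have Dn := log_delta_le delta0 delta_range.
set D := ln delta^-1 in D1 Dn.
pose a : R := 100 * k%:R * r.
pose l : R := 8 * k%:R * ln (n%:R / delta).
have log1 := log_sample_ge1 delta0 delta_range.
have l0 : 0 < l.
  by apply: mulr_gt0; [rewrite mulr_gt0|exact: lt_le_trans ltr01 log1].
have lna : l <= n%:R * a := log_radius delta0 delta_range k.
have kl : k%:R <= l.
  rewrite /l (mulrC 8) -mulrA ler_peMr ?(ltW k0')//; lra.
have H1 := grid_event_pr iid cF n0 l0 lna (union_bound_small delta0 delta_range hk).
have Dn16 : 16 * D <= n%:R by lra.
have H2 := fails_with_pr_all_const (fun j => margin_dev_uniform iid cF j D1 Dn16).
have H3 := unif_obs_distinct iid cF delta0.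
have [A [mA PA AH]] := fails_with_pr_and (fails_with_pr_and H1 H2) H3.
exists A; split => //.
  rewrite prE// lee_fin; move: PA; rewrite pr_setC// (log_delta delta0) card_ord.
  (* The total failure [d^k delta + d delta + delta] is below the allowed one. *)
  have : 2 <= d%:R :> R by rewrite (ler_nat _ 2).
  move: (d%:R ^+ k * delta) (mulrDl (9 * d%:R) (d%:R ^+ k) delta) => q -> h.
  have : 2 * delta <= d%:R * delta by rewrite ler_wpM2r// ltW.
  lra.
move=> w /AH[[grid_ok margin_ok] [U_gt0 U_inj]].
apply: ge_ereal_sup => _ [u Wu <-]; rewrite lee_fin.
have margin_ok' j t : 0 <= t <= 1 ->
    `|margin_dev X mu j t w| <= 56 * Num.sqrt (n%:R * D).
  by apply: margin_ok; exact: (margin_dev0 cF U_gt0).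
have := pathwise_bound cF CC U_gt0 U_inj hk d0 n0 C_reg grid_ok margin_ok' kl lna
  (dkw_radius delta0 delta_range hk) Wu.
have s0 : 0 < Num.sqrt (n%:R : R) by rewrite sqrtr_gt0.
rewrite normrM (ger0_norm (ltW s0)) -ler_pdivlMl// => /le_trans; apply.
have -> : Num.sqrt (n%:R * a * l) = Num.sqrt n%:R * Num.sqrt (a * l).
  by rewrite -mulrA sqrtrM// ltW.
(* [a l = 800 k^2 r ln (n / delta)] is at most [1600 k^2 r ln (1 / (delta r))], and
   [1600 = 40^2]. *)
have ral : Num.sqrt (a * l) <= 40 * k%:R * Num.sqrt (r * ln (1 / (delta * r))).
  have h := log_sample_le_rate delta0 delta_range.
  have k40 : 0 <= 40 * k%:R :> R by rewrite mulr_ge0 ?ler0n.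
  rewrite -[in leRHS](ger0_norm k40) -sqrtr_sqr -sqrtrM ?sqr_ge0//.
  apply: ler_wsqrtr.
  have c2 : 0 <= 800 * k%:R ^+ 2 * r.
    apply: mulr_ge0 (ltW r0); apply: mulr_ge0; last by rewrite exprn_ge0 ?ler0n.
    lra.
  have := ler_wpM2l c2 h; rewrite /a /l; lra.
move: (Num.sqrt (a * l)) (Num.sqrt (r * ln (1 / (delta * r)))) ral => Z Y ZY.
rewrite mulrDr; apply: lerD.
  by rewrite mulrC ler_pM2r ?invr_gt0//; lra.
rewrite (mulrCA _ (Num.sqrt n%:R)) mulKf ?gt_eqF//.
have c2 : 0 <= 1000 * k%:R ^+ 3 * (1 + `|K|).
  by apply: mulr_ge0 (ltW K1); apply: mulr_ge0 (ltW c0) _; rewrite exprn_ge0 ?ler0n.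
have := ler_wpM2l c2 ZY; lra.
Qed.
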